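(* Let $\mathcal A=\{1,\dots,m\}$, $\mathbb X=\mathcal A^{\mathbb Z}$ with left shift $S$, $\mu=\mu_0^{\mathbb Z}$ with $\mu_0$ a probability measure on $\mathcal A$ satisfying $\mu_0(\{a\})>0$ for all $a$, and $\nu=\mu\times\mu'$ where $\mu'$ is normalized counting measure on $\mathbb Z_2$. Let $T(x,j)=(Sx,j+1\bmod 2)$ on $\mathbb X\times\mathbb Z_2$, let $g:\mathcal A\times\mathbb Z_2\to\mathbb R$, $f(x,j)=g(x_0,j)$, and $H_\omega=\Delta+V_\omega$ with $V_\omega(n)=f(T^n\omega)$. For $a,b\in\mathcal A$ let $\omega_{ab}=((ab)^{\mathbb Z},0)$, where $(ab)^{\mathbb Z}$ has $a$ at even and $b$ at odd positions. Then for $\nu$-almost every $\omega$, $$\sigma(H_\omega)=\bigcup_{a,b\in\mathcal A}\sigma(H_{\omega_{ab}}),$$ and for every $\omega\in\mathbb X\times\mathbb Z_2$, $\sigma(H_\omega)\subseteq\bigcup_{a,b\in\mathcal A}\sigma(H_{\omega_{ab}})$.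
   Context: $\Delta$ is the discrete Laplacian $(\Delta\psi)(n)=\psi(n+1)+\psi(n-1)$ on $\ell^2(\mathbb Z)$. *)

(* Defs.v *)
From Stdlib Require Import Reals ZArith Lra.
From Coquelicot Require Import Coquelicot.
Open Scope R_scope.

Definition pt := ((Z -> nat) * Z)%type.

Definition in_X (m : nat) (w : pt) : Prop :=
  (forall n, (1 <= fst w n <= m)%nat) /\ (snd w = 0%Z \/ snd w = 1%Z).

Definition Tpow (n : Z) (w : pt) : pt :=
  (fun k => fst w (k + n)%Z, Z.modulo (snd w + n) 2).

Definition fpot (g : nat -> Z -> R) (w : pt) : R := g (fst w 0%Z) (snd w).

Definition Vpot (g : nat -> Z -> R) (w : pt) : Z -> R :=
  fun n => fpot g (Tpow n w).

Definition omega_ab (a b : nat) : pt :=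
  (fun n => if Z.even n then a else b, 0%Z).

Definition l2 (psi : Z -> C) : Prop :=
  ex_series (fun n : nat => (Cmod (psi (Z.of_nat n))) ^ 2) /\
  ex_series (fun n : nat => (Cmod (psi (- Z.of_nat (S n))%Z)) ^ 2).

Definition Hop (V : Z -> R) (psi : Z -> C) : Z -> C :=
  fun n => (psi (n + 1)%Z + psi (n - 1)%Z + RtoC (V n) * psi n)%C.

(** z in sigma(H_V): H_V - z is not a bijection of l^2(Z) onto itself
    (for the bounded operator H_V this is the usual spectrum, by the
    bounded inverse theorem). *)
Definition in_spectrum (V : Z -> R) (z : C) : Prop :=
  ~ (forall phi, l2 phi ->
       exists psi, l2 psi /\ (forall n, (Hop V psi n - z * psi n)%C = phi n) /\
         (forall psi', l2 psi' -> (forall n, (Hop V psi' n - z * psi' n)%C = phi n) ->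
            psi' = psi)).

Definition cyl := (nat * (Z -> nat) * Z)%type.

Definition in_cyl (c : cyl) (w : pt) : Prop :=
  let '(k, u, j) := c in
  snd w = j /\ forall n : Z, (- Z.of_nat k <= n <= Z.of_nat k)%Z -> fst w n = u n.

Definition nu_cyl (m : nat) (p : nat -> R) (c : cyl) : R :=
  let '(k, u, j) := c in
  (if orb (Z.eqb j 0) (Z.eqb j 1) then / 2 else 0) *
  prod_f_R0 (fun i => let a := u (Z.of_nat i - Z.of_nat k)%Z in
                      if andb (Nat.leb 1 a) (Nat.leb a m) then p a else 0) (2 * k).

(** nu-null subset of X x Z_2 (outer measure zero, i.e. null for the
    completed product measure): coverable by countably many cylinders of
    arbitrarily small total measure. *)
Definition nu_null (m : nat) (p : nat -> R) (N : pt -> Prop) : Prop :=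
  forall eps, 0 < eps ->
    exists cover : nat -> cyl,
      (forall w, in_X m w -> N w -> exists i, in_cyl (cover i) w) /\
      (forall K, sum_n (fun i => nu_cyl m p (cover i)) K <= eps).

Definition nu_ae (m : nat) (p : nat -> R) (P : pt -> Prop) : Prop :=
  nu_null m p (fun w => ~ P w).

(* Main.v *)
Require Import Defs.
From Stdlib Require Import Reals ZArith Lra Lia List Cantor FinFun.
From Stdlib Require Import FunctionalExtensionality Classical ClassicalEpsilon.
From Coquelicot Require Import Coquelicot.
Open Scope R_scope.

(** Both spectra are governed by the period-two discriminant: z is in the spectrum of some H_w only
    if z = E is real and 0 <= (E - g(a,0)) (E - g(b,1)) <= 4 for some letters a, b, and for such
    a, b, E the existence of arbitrarily long blocks abab...ab in w puts E in the spectrum.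

    Necessity: H - z is invertible as soon as s (H - z) is coercive for some unimodular diagonal s
    (Lax-Milgram, by the iteration psi <- psi - tau s ((H - z) psi - phi)).  For z not real take
    s = +i or -i.  For z = E take s(n) = - sgn(E - V(n)): where E - V changes sign the hopping terms
    cancel, and where it does not, the product of neighbouring values exceeds 4 uniformly, so that
    AM-GM absorbs the hopping terms.

    Sufficiency: on a block the Bloch wave u of the ab-periodic operator has constant modulus along
    each sublattice; if phi = (H - E) psi with psi square summable, Green's identity bounds the
    pairing of phi with u over a block by boundary terms.  A phi proportional to u on blocks of
    length ~ 16^k with amplitude at least 8^-k is square summable and violates this bound, so H - E
    is not onto.

    Almost every w contains all blocks, by covering the exceptional set with the words of a long
    window that avoid a block at T disjoint places; their measure decays geometrically in T. *)

(** * Two-sided sums *)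

Definition nsq (z : C) : R := fst z * fst z + snd z * snd z.
Definition dot (z w : C) : R := fst z * fst w + snd z * snd w.

Lemma nsq_ge0 z : 0 <= nsq z.
Proof. unfold nsq; nra. Qed.

Lemma Cmod_sq z : Cmod z ^ 2 = nsq z.
Proof. unfold Cmod, nsq. rewrite pow2_sqrt; nra. Qed.

Lemma nsq_eq0 z : nsq z <= 0 -> z = 0%C.
Proof.
  destruct z as [x y]; unfold nsq; simpl; intros H.
  assert (x = 0) by nra. assert (y = 0) by nra. subst. reflexivity.
Qed.

Lemma sum_n_S (f : nat -> R) n : sum_n f (S n) = sum_n f n + f (S n).
Proof. now rewrite sum_Sn. Qed.

Lemma sum_n_0 (f : nat -> R) : sum_n f 0 = f 0%nat.
Proof. now rewrite sum_O. Qed.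

Lemma ex_series_bounded (f : nat -> R) :
  (forall n, 0 <= f n) ->
  ex_series f <-> exists B, forall N, sum_n f N <= B.
Proof.
  intros Hf.
  assert (Hi : forall n, sum_n f n <= sum_n f (S n)).
  { intros n. rewrite sum_n_S. specialize (Hf (S n)). lra. }
  split.
  - intros [l Hl]. exists l. intros N.
    apply (is_lim_seq_incr_compare (sum_n f)); [exact Hl | exact Hi].
  - intros [B HB].
    destruct (ex_finite_lim_seq_incr (sum_n f) B Hi HB) as [l Hl].
    exists l. exact Hl.
Qed.

Definition zsum (f : Z -> R) (N : nat) : R :=
  sum_n (fun k => f (Z.of_nat k)) N + sum_n (fun k => f (- Z.of_nat (S k))%Z) N.

Lemma zsum_0 f : zsum f 0 = f 0%Z + f (-1)%Z.
Proof. unfold zsum. now rewrite !sum_n_0. Qed.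

Lemma zsum_S f N :
  zsum f (S N) = zsum f N + f (Z.of_nat (S N)) + f (- Z.of_nat (S (S N)))%Z.
Proof. unfold zsum. rewrite !sum_n_S. lra. Qed.

Lemma zsum_le f g N : (forall n, f n <= g n) -> zsum f N <= zsum g N.
Proof.
  intros H. induction N as [|N IH].
  - rewrite !zsum_0. pose proof (H 0%Z); pose proof (H (-1)%Z); lra.
  - rewrite !zsum_S. pose proof (H (Z.of_nat (S N))).
    pose proof (H (- Z.of_nat (S (S N)))%Z). lra.
Qed.

Lemma zsum_lin f g a b N :
  zsum (fun n => a * f n + b * g n) N = a * zsum f N + b * zsum g N.
Proof.
  induction N as [|N IH].
  - rewrite !zsum_0. lra.
  - rewrite !zsum_S, IH. lra.
Qed.

Lemma zsum_telescope T N :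
  zsum (fun n => T (n + 1)%Z - T n) N
  = T (Z.of_nat (S N)) - T (- Z.of_nat (S N))%Z.
Proof.
  induction N as [|N IH].
  - rewrite zsum_0. simpl. lra.
  - rewrite zsum_S, IH.
    replace (Z.of_nat (S N) + 1)%Z with (Z.of_nat (S (S N))) by lia.
    replace (- Z.of_nat (S (S N)) + 1)%Z with (- Z.of_nat (S N))%Z by lia. lra.
Qed.

Lemma zsum_incr f N M :
  (forall n, 0 <= f n) -> (N <= M)%nat -> zsum f N <= zsum f M.
Proof.
  intros Hf H. induction H as [|M H IH]; [lra|].
  rewrite zsum_S. pose proof (Hf (Z.of_nat (S M))).
  pose proof (Hf (- Z.of_nat (S (S M)))%Z). lra.
Qed.

Lemma zsum_ge_term f n :
  (forall k, 0 <= f k) -> exists N, f n <= zsum f N.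
Proof.
  intros Hf.
  assert (Hz : forall N, 0 <= zsum f N).
  { intros N. apply Rle_trans with (zsum f 0); [|apply zsum_incr; [exact Hf|lia]].
    rewrite zsum_0. pose proof (Hf 0%Z); pose proof (Hf (-1)%Z); lra. }
  exists (Z.abs_nat n).
  destruct (Z.abs_nat n) as [|N] eqn:E.
  - assert (n = 0)%Z by lia. subst. rewrite zsum_0. pose proof (Hf (-1)%Z). lra.
  - rewrite zsum_S. pose proof (Hz N) as HN.
    pose proof (Hf (Z.of_nat (S N))). pose proof (Hf (- Z.of_nat (S (S N)))%Z).
    destruct (Z_le_gt_dec 0 n).
    + replace n with (Z.of_nat (S N)) by lia. lra.
    + clear HN. replace n with (- Z.of_nat (S N))%Z by lia.
      destruct N as [|N].
      * rewrite zsum_0. simpl. pose proof (Hf 0%Z). pose proof (Hf 1%Z).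
        pose proof (Hf (-2)%Z). lra.
      * rewrite zsum_S. pose proof (Hz N). pose proof (Hf (Z.of_nat (S N))). lra.
Qed.

Lemma l2_iff_bounded psi :
  l2 psi <-> exists B, forall N, zsum (fun n => nsq (psi n)) N <= B.
Proof.
  assert (E : forall f : nat -> Z,
    ex_series (fun n => Cmod (psi (f n)) ^ 2) <->
    exists B, forall N, sum_n (fun n => nsq (psi (f n))) N <= B).
  { intros f. rewrite <- ex_series_bounded by (intros; apply nsq_ge0).
    split; apply ex_series_ext; intros; now rewrite Cmod_sq. }
  assert (P : forall (f : nat -> Z) N, 0 <= sum_n (fun n => nsq (psi (f n))) N).
  { intros f N. induction N as [|N IH].
    - rewrite sum_n_0. apply nsq_ge0.
    - rewrite sum_n_S. pose proof (nsq_ge0 (psi (f (S N)))). lra. }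
  unfold l2.
  rewrite (E (fun n => Z.of_nat n)), (E (fun n => (- Z.of_nat (S n))%Z)).
  split.
  - intros [[B HB] [B' HB']]. exists (B + B'). intros N. unfold zsum.
    specialize (HB N); specialize (HB' N). lra.
  - intros [B HB]. split; exists B; intros N; specialize (HB N); unfold zsum in HB.
    + pose proof (P (fun k => (- Z.of_nat (S k))%Z) N). lra.
    + pose proof (P (fun k => Z.of_nat k) N). lra.
Qed.

Lemma bounded_incr_small_step (w : nat -> R) B :
  (forall n, w n <= w (S n)) -> (forall n, w n <= B) ->
  forall eps N0, 0 < eps -> exists M, (N0 <= M)%nat /\ w (S (S M)) - w M < eps.
Proof.
  intros Hi HB eps N0 He.
  destruct (ex_finite_lim_seq_incr w B Hi HB) as [l Hl].
  pose proof (is_lim_seq_incr_compare w l Hl Hi) as Hle.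
  apply is_lim_seq_spec in Hl. destruct (Hl (mkposreal eps He)) as [N HN].
  exists (N + N0)%nat. split; [lia|].
  specialize (HN (N + N0)%nat ltac:(lia)). simpl in HN.
  apply Rabs_def2 in HN. specialize (Hle (S (S (N + N0)))). lra.
Qed.

(* The telescoping term contributes only boundary values, and these tend to 0 along a summable sequence. *)
Lemma zsum_bound_telescope (e e' T : Z -> R) r B K :
  0 <= r -> 0 <= K -> (forall n, 0 <= e n) -> (forall n, 0 <= e' n) ->
  (forall n, e' n <= r * e n + (T (n + 1)%Z - T n)) ->
  (forall n, Rabs (T n) <= K * (e n + e (n - 1)%Z)) ->
  (forall N, zsum e N <= B) -> forall N, zsum e' N <= r * B.
Proof.
  intros Hr HK He He' Hl HT HB N.
  apply le_epsilon. intros eps Heps.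
  assert (Hi : forall n, zsum e n <= zsum e (S n)).
  { intros n. apply zsum_incr; [exact He | lia]. }
  destruct (bounded_incr_small_step (zsum e) B Hi HB (eps / (K + 1)) N) as [M [HM Hs]].
  { apply Rdiv_lt_0_compat; lra. }
  apply Rle_trans with (zsum e' (S M)).
  { apply zsum_incr; [exact He' | lia]. }
  apply Rle_trans with (zsum (fun n => r * e n + 1 * (T (n + 1)%Z - T n)) (S M)).
  { apply zsum_le. intros n. specialize (Hl n). lra. }
  rewrite (zsum_lin e (fun n => T (n + 1)%Z - T n)), zsum_telescope.
  pose proof (HT (Z.of_nat (S (S M)))) as H1.
  pose proof (HT (- Z.of_nat (S (S M)))%Z) as H2.
  replace (Z.of_nat (S (S M)) - 1)%Z with (Z.of_nat (S M)) in H1 by lia.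
  replace (- Z.of_nat (S (S M)) - 1)%Z with (- Z.of_nat (S (S (S M))))%Z in H2 by lia.
  apply Rabs_le_between in H1. apply Rabs_le_between in H2.
  rewrite (zsum_S e (S M)), (zsum_S e M) in Hs.
  assert (r * zsum e (S M) <= r * B) by (apply Rmult_le_compat_l; auto).
  apply (Rmult_lt_compat_l (K + 1)) in Hs; [|lra].
  replace ((K + 1) * (eps / (K + 1))) with eps in Hs by (field; lra).
  pose proof (He (Z.of_nat (S M))). pose proof (He (Z.of_nat (S (S M)))).
  pose proof (He (- Z.of_nat (S (S M)))%Z). pose proof (He (- Z.of_nat (S (S (S M))))%Z).
  nra.
Qed.

Lemma nsq_add_weighted x y X Y : 0 < X -> 0 < Y ->
  nsq (x + y)%C <= (1 + Y / X) * nsq x + (1 + X / Y) * nsq y.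
Proof.
  intros HX HY. destruct x as [a b], y as [c d]. unfold nsq; simpl.
  assert (Hk : forall u v : R, 2 * u * v <= Y / X * (u * u) + X / Y * (v * v)).
  { intros u v.
    assert (0 <= (Y * u - X * v) ^ 2 / (X * Y)).
    { apply Rdiv_le_0_compat; [apply pow2_ge_0 | now apply Rmult_lt_0_compat]. }
    replace ((Y * u - X * v) ^ 2 / (X * Y))
      with (Y / X * (u * u) + X / Y * (v * v) - 2 * u * v) in H by (field; lra).
    lra. }
  pose proof (Hk a c). pose proof (Hk b d). lra.
Qed.

Lemma zsum_minkowski (x y : Z -> C) X Y : 0 < X -> 0 < Y ->
  (forall N, zsum (fun n => nsq (x n)) N <= X ^ 2) ->
  (forall N, zsum (fun n => nsq (y n)) N <= Y ^ 2) ->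
  forall N, zsum (fun n => nsq (x n + y n)%C) N <= (X + Y) ^ 2.
Proof.
  intros HX HY Hx Hy N.
  eapply Rle_trans.
  { apply zsum_le. intros n. apply (nsq_add_weighted (x n) (y n) X Y HX HY). }
  rewrite (zsum_lin (fun n => nsq (x n)) (fun n => nsq (y n))).
  assert (0 < Y / X) by (apply Rdiv_lt_0_compat; lra).
  assert (0 < X / Y) by (apply Rdiv_lt_0_compat; lra).
  replace ((X + Y) ^ 2) with ((1 + Y / X) * X ^ 2 + (1 + X / Y) * Y ^ 2)
    by (field; lra).
  apply Rplus_le_compat; apply Rmult_le_compat_l; auto; lra.
Qed.

Lemma is_lim_zsum (f : nat -> Z -> R) (F : Z -> R) N :
  (forall n, is_lim_seq (fun k => f k n) (F n)) ->
  is_lim_seq (fun k => zsum (f k) N) (zsum F N).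
Proof.
  intros H. induction N as [|N IH].
  - rewrite zsum_0.
    apply is_lim_seq_ext with (fun k => f k 0%Z + f k (-1)%Z).
    { intros k. now rewrite zsum_0. }
    apply is_lim_seq_plus'; apply H.
  - rewrite zsum_S.
    eapply is_lim_seq_ext.
    { intros k. symmetry. apply zsum_S. }
    apply is_lim_seq_plus'; [apply is_lim_seq_plus'|]; auto.
Qed.

(** * Coercive operators are bijective *)

Definition shifted (V : Z -> R) (z : C) (psi : Z -> C) (n : Z) : C :=
  (Hop V psi n - z * psi n)%C.

Lemma shifted_plus V z f g n :
  shifted V z (fun k => f k + g k)%C n = (shifted V z f n + shifted V z g n)%C.
Proof. unfold shifted, Hop. ring. Qed.

Definition richardson (V : Z -> R) (z : C) (s : Z -> C) (tau : R) (d : Z -> C) : Z -> C :=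
  fun n => (d n - RtoC tau * (s n * shifted V z d n))%C.

Definition coercive_with (V : Z -> R) (z : C) (s : Z -> C)
    (T : (Z -> C) -> Z -> R) (c : R) : Prop :=
  forall d n, c * nsq (d n) + (T d (n + 1)%Z - T d n) <= dot (d n) (s n * shifted V z d n)%C.

Definition boundary_bounded (T : (Z -> C) -> Z -> R) (K : R) : Prop :=
  forall d n, Rabs (T d n) <= K * (nsq (d n) + nsq (d (n - 1)%Z)).

Lemma nsq_mult x y : nsq (x * y)%C = nsq x * nsq y.
Proof. destruct x, y; unfold nsq; simpl; ring. Qed.

Lemma nsq_shifted V z d n K : nsq (RtoC (V n) - z)%C <= K ->
  nsq (shifted V z d n)
  <= 3 * (K * nsq (d n) + nsq (d (n + 1)%Z) + nsq (d (n - 1)%Z)).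
Proof.
  intros HK.
  assert (H3 : forall a b c : C, nsq (a + b + c)%C <= 3 * (nsq a + nsq b + nsq c)).
  { intros [a a'] [b b'] [c c']; unfold nsq; simpl.
    pose proof (pow2_ge_0 (a - b)). pose proof (pow2_ge_0 (a - c)).
    pose proof (pow2_ge_0 (b - c)). pose proof (pow2_ge_0 (a' - b')).
    pose proof (pow2_ge_0 (a' - c')). pose proof (pow2_ge_0 (b' - c')). lra. }
  replace (shifted V z d n)
    with ((RtoC (V n) - z) * d n + d (n + 1)%Z + d (n - 1)%Z)%C
    by (unfold shifted, Hop; ring).
  eapply Rle_trans; [apply H3|]. rewrite nsq_mult.
  pose proof (Rmult_le_compat_r (nsq (d n)) _ _ (nsq_ge0 _) HK). lra.
Qed.

Lemma richardson_contracts V z s T c K L :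
  0 < c -> 0 <= L ->
  (forall n, nsq (s n) = 1) ->
  (forall n, nsq (RtoC (V n) - z)%C <= K) ->
  coercive_with V z s T c -> boundary_bounded T L ->
  exists tau r, 0 < tau /\ 0 <= r < 1 /\
    forall d B, (forall N, zsum (fun n => nsq (d n)) N <= B) ->
      forall N, zsum (fun n => nsq (richardson V z s tau d n)) N <= r * B.
Proof.
  intros Hc HL Hs HK Hco Hbd.
  assert (HK0 : 0 <= K).
  { eapply Rle_trans; [apply nsq_ge0 | apply (HK 0%Z)]. }
  set (D := 3 * (K + 2) + c ^ 2).
  assert (HD : 0 < D) by (unfold D; pose proof (pow2_ge_0 c); lra).
  set (tau := c / D).
  assert (Htau : 0 < tau) by (apply Rdiv_lt_0_compat; lra).
  assert (HtD : tau * D = c) by (unfold tau; field; lra).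
  exists tau, (1 - tau * c). split; [exact Htau|]. split.
  { split; [|nra].
    assert (tau * c <= 1); [|lra].
    unfold tau. apply (Rmult_le_reg_l D); [lra|].
    replace (D * (c / D * c)) with (c ^ 2) by (field; lra). unfold D; lra. }
  intros d B HB.
  apply (zsum_bound_telescope (fun n => nsq (d n)) _
    (fun n => (-2 * tau) * T d n + 3 * tau ^ 2 * (nsq (d n) - nsq (d (n - 1)%Z)))
    (1 - tau * c) B (2 * tau * L + 3 * tau ^ 2)).
  - assert (tau * c <= 1); [|lra].
    unfold tau. apply (Rmult_le_reg_l D); [lra|].
    replace (D * (c / D * c)) with (c ^ 2) by (field; lra). unfold D; lra.
  - pose proof (pow2_ge_0 tau). nra.
  - intros; apply nsq_ge0.
  - intros; apply nsq_ge0.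
  - intros n.
    assert (E : nsq (richardson V z s tau d n)
      = nsq (d n) - 2 * tau * dot (d n) (s n * shifted V z d n)%C
        + tau ^ 2 * nsq (shifted V z d n)).
    { unfold richardson.
      replace (nsq (shifted V z d n)) with (nsq (s n * shifted V z d n)%C)
        by (rewrite nsq_mult, Hs; ring).
      generalize (s n * shifted V z d n)%C (d n). intros [a b] [e f].
      unfold nsq, dot; simpl; ring. }
    rewrite E.
    replace (n + 1 - 1)%Z with n by lia.
    pose proof (Hco d n) as H1.
    pose proof (nsq_shifted V z d n K (HK n)) as H2.
    apply (Rmult_le_compat_l (2 * tau)) in H1; [|lra].
    apply (Rmult_le_compat_l (tau ^ 2)) in H2; [|apply pow2_ge_0].
    assert (H3 : tau ^ 2 * (3 * (K + 2)) <= tau * c).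
    { rewrite <- HtD. unfold D. pose proof (pow2_ge_0 tau). pose proof (pow2_ge_0 c). nra. }
    pose proof (Rmult_le_compat_r (nsq (d n)) _ _ (nsq_ge0 _) H3) as H4.
    lra.
  - intros n. pose proof (Hbd d n) as H. apply Rabs_le_between in H.
    pose proof (nsq_ge0 (d n)). pose proof (nsq_ge0 (d (n - 1)%Z)).
    pose proof (pow2_ge_0 tau).
    apply Rabs_le_between.
    assert (- (L * (nsq (d n) + nsq (d (n - 1)%Z))) * (2 * tau) <= T d n * (2 * tau))
      by (apply Rmult_le_compat_r; lra).
    assert (T d n * (2 * tau) <= (L * (nsq (d n) + nsq (d (n - 1)%Z))) * (2 * tau))
      by (apply Rmult_le_compat_r; lra).
    assert (0 <= tau ^ 2 * nsq (d n)) by (apply Rmult_le_pos; lra).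
    assert (0 <= tau ^ 2 * nsq (d (n - 1)%Z)) by (apply Rmult_le_pos; lra).
    split; lra.
  - exact HB.
Qed.

Fixpoint increment (A : (Z -> C) -> Z -> C) (d0 : Z -> C) (k : nat) : Z -> C :=
  match k with O => d0 | S k => A (increment A d0 k) end.

Fixpoint iterate (A : (Z -> C) -> Z -> C) (d0 : Z -> C) (k : nat) : Z -> C :=
  match k with
  | O => d0
  | S k => fun n => (iterate A d0 k n + increment A d0 (S k) n)%C
  end.

Lemma iterate_sum A d0 k n :
  sum_n (fun i => fst (increment A d0 i n)) k = fst (iterate A d0 k n) /\
  sum_n (fun i => snd (increment A d0 i n)) k = snd (iterate A d0 k n).
Proof.
  induction k as [|k [IH1 IH2]].
  - now rewrite !sum_n_0.
  - rewrite !sum_n_S, IH1, IH2. split; reflexivity.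
Qed.

Lemma richardson_residual V z s tau phi k n :
  let A := richardson V z s tau in
  let d0 := fun n => (RtoC tau * (s n * phi n))%C in
  (RtoC tau * (s n * shifted V z (iterate A d0 k) n))%C
  = (RtoC tau * (s n * phi n) - increment A d0 (S k) n)%C.
Proof.
  intros A d0. induction k as [|k IH].
  - simpl. unfold A at 1, richardson. unfold d0 at 2. ring.
  - change (iterate A d0 (S k)) with (fun n => (iterate A d0 k n + increment A d0 (S k) n)%C).
    rewrite shifted_plus.
    transitivity (RtoC tau * (s n * shifted V z (iterate A d0 k) n)
                  + RtoC tau * (s n * shifted V z (increment A d0 (S k)) n))%C; [ring|].
    rewrite IH.
    change (increment A d0 (S (S k)) n) with
      (increment A d0 (S k) n
       - RtoC tau * (s n * shifted V z (increment A d0 (S k)) n))%C.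
    ring.
Qed.

Lemma is_lim_seq_nsq (f : nat -> C) (l : C) :
  is_lim_seq (fun k => fst (f k)) (fst l) -> is_lim_seq (fun k => snd (f k)) (snd l) ->
  is_lim_seq (fun k => nsq (f k)) (nsq l).
Proof.
  intros H1 H2. unfold nsq.
  apply is_lim_seq_plus'; apply is_lim_seq_mult'; auto.
Qed.

Lemma is_lim_seq_shifted V z (f : nat -> Z -> C) (l : Z -> C) w n :
  (forall n, is_lim_seq (fun k => fst (f k n)) (fst (l n))) ->
  (forall n, is_lim_seq (fun k => snd (f k n)) (snd (l n))) ->
  is_lim_seq (fun k => nsq (shifted V z (f k) n - w)%C) (nsq (shifted V z l n - w)%C).
Proof.
  intros H1 H2.
  assert (E1 : forall g, fst (shifted V z g n - w)%C
    = fst (g (n + 1)%Z) + fst (g (n - 1)%Z) + ((V n - fst z) * fst (g n) + snd z * snd (g n)) + - fst w).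
  { intros g. unfold shifted, Hop. simpl. ring. }
  assert (E2 : forall g, snd (shifted V z g n - w)%C
    = snd (g (n + 1)%Z) + snd (g (n - 1)%Z) + ((V n - fst z) * snd (g n) + - snd z * fst (g n)) + - snd w).
  { intros g. unfold shifted, Hop. simpl. ring. }
  apply is_lim_seq_nsq.
  - rewrite E1. eapply is_lim_seq_ext; [intros k; symmetry; apply E1|].
    repeat apply is_lim_seq_plus'; try apply is_lim_seq_mult'; auto; apply is_lim_seq_const.
  - rewrite E2. eapply is_lim_seq_ext; [intros k; symmetry; apply E2|].
    repeat apply is_lim_seq_plus'; try apply is_lim_seq_mult'; auto; apply is_lim_seq_const.
Qed.

Lemma nsq_bounds z b : 0 <= b -> nsq z <= b ^ 2 -> Rabs (fst z) <= b /\ Rabs (snd z) <= b.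
Proof.
  destruct z as [x y]; unfold nsq; simpl; intros Hb H.
  split; apply Rabs_le; nra.
Qed.

Section Contraction.
Variables (A : (Z -> C) -> Z -> C) (d0 : Z -> C) (q b : R).
Hypothesis (Hq : 0 < q < 1) (Hb : 0 < b).
Hypothesis A_contracts : forall d B, (forall N, zsum (fun n => nsq (d n)) N <= B) ->
  forall N, zsum (fun n => nsq (A d n)) N <= q ^ 2 * B.
Hypothesis d0_bounded : forall N, zsum (fun n => nsq (d0 n)) N <= b ^ 2.

Lemma increment_norm k N : zsum (fun n => nsq (increment A d0 k n)) N <= (b * q ^ k) ^ 2.
Proof.
  revert N. induction k as [|k IH]; intros N.
  - simpl increment. rewrite pow_O, Rmult_1_r. apply d0_bounded.
  - simpl increment. replace ((b * q ^ S k) ^ 2) with (q ^ 2 * (b * q ^ k) ^ 2) by (simpl; ring).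
    now apply A_contracts.
Qed.

Lemma increment_pointwise k n : nsq (increment A d0 k n) <= (b * q ^ k) ^ 2.
Proof.
  destruct (zsum_ge_term (fun n => nsq (increment A d0 k n)) n) as [N HN].
  { intros; apply nsq_ge0. }
  eapply Rle_trans; [exact HN | apply increment_norm].
Qed.

Lemma iterate_norm k N :
  zsum (fun n => nsq (iterate A d0 k n)) N <= (b * (1 - q ^ S k) / (1 - q)) ^ 2.
Proof.
  revert N. induction k as [|k IH]; intros N.
  - simpl iterate. replace (b * (1 - q ^ 1) / (1 - q)) with b by (field; lra). apply d0_bounded.
  - replace (b * (1 - q ^ S (S k)) / (1 - q))
      with (b * (1 - q ^ S k) / (1 - q) + b * q ^ S k) by (simpl; field; lra).
    assert (0 < q ^ S k) by (apply pow_lt; lra).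
    assert (q ^ S k < 1).
    { apply Rle_lt_trans with q; [|lra]. simpl.
      assert (q ^ k <= 1) by (rewrite <- (pow1 k); apply pow_incr; lra). nra. }
    refine (zsum_minkowski (iterate A d0 k) (increment A d0 (S k)) _ _ _ _ IH
              (increment_norm (S k)) N).
    + apply Rdiv_lt_0_compat; [|lra]. apply Rmult_lt_0_compat; lra.
    + apply Rmult_lt_0_compat; lra.
Qed.

Lemma is_lim_seq_geom_bound c : is_lim_seq (fun k => (c * q ^ k)) 0.
Proof.
  replace (Finite 0) with (Finite (c * 0)) by (f_equal; ring).
  apply is_lim_seq_mult'; [apply is_lim_seq_const|].
  apply is_lim_seq_geom. rewrite Rabs_pos_eq; lra.
Qed.

Lemma iterate_converges : exists psi : Z -> C, l2 psi /\
  (forall n, is_lim_seq (fun k => fst (iterate A d0 k n)) (fst (psi n))) /\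
  (forall n, is_lim_seq (fun k => snd (iterate A d0 k n)) (snd (psi n))).
Proof.
  assert (Hg : ex_series (fun k => b * q ^ k)).
  { apply ex_series_scal_l with (a := fun k => q ^ k) (c := b).
    apply ex_series_geom. rewrite Rabs_pos_eq; lra. }
  assert (Hp : forall k, 0 <= b * q ^ k).
  { intros k. apply Rmult_le_pos; [lra | apply pow_le; lra]. }
  exists (fun n => (Series (fun k => fst (increment A d0 k n)),
                    Series (fun k => snd (increment A d0 k n)))).
  match goal with |- l2 ?p /\ _ => set (psi := p) end.
  assert (Hl : (forall n, is_lim_seq (fun k => fst (iterate A d0 k n)) (fst (psi n))) /\
    (forall n, is_lim_seq (fun k => snd (iterate A d0 k n)) (snd (psi n)))).
  { split; intros n.
    - eapply is_lim_seq_ext; [intros k; apply (proj1 (iterate_sum A d0 k n))|].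
      apply (Series_correct (fun k => fst (increment A d0 k n))).
      apply (@ex_series_le R_AbsRing R_CompleteNormedModule _ (fun k => b * q ^ k)); [|exact Hg].
      intros k. apply (nsq_bounds _ _ (Hp k) (increment_pointwise k n)).
    - eapply is_lim_seq_ext; [intros k; apply (proj2 (iterate_sum A d0 k n))|].
      apply (Series_correct (fun k => snd (increment A d0 k n))).
      apply (@ex_series_le R_AbsRing R_CompleteNormedModule _ (fun k => b * q ^ k)); [|exact Hg].
      intros k. apply (nsq_bounds _ _ (Hp k) (increment_pointwise k n)). }
  split; [|exact Hl].
  apply l2_iff_bounded. exists ((b / (1 - q)) ^ 2). intros N.
  apply (is_lim_seq_le (fun k => zsum (fun n => nsq (iterate A d0 k n)) N)
           (fun _ => (b / (1 - q)) ^ 2) (zsum (fun n => nsq (psi n)) N) ((b / (1 - q)) ^ 2)).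
  - intros k. eapply Rle_trans; [apply iterate_norm|].
    assert (0 < q ^ S k) by (apply pow_lt; lra).
    assert (q ^ S k <= 1) by (rewrite <- (pow1 (S k)); apply pow_incr; lra).
    assert (0 < / (1 - q)) by (apply Rinv_0_lt_compat; lra).
    apply pow_incr. split.
    + apply Rmult_le_pos; [apply Rmult_le_pos|]; lra.
    + apply Rmult_le_compat_r; nra.
  - apply (is_lim_zsum (fun k n => nsq (iterate A d0 k n))).
    intros n. exact (is_lim_seq_nsq (fun k => iterate A d0 k n) (psi n) (proj1 Hl n) (proj2 Hl n)).
  - apply is_lim_seq_const.
Qed.

End Contraction.

Lemma contraction_fixed_zero (A : (Z -> C) -> Z -> C) r e :
  0 <= r < 1 ->
  (forall d B, (forall N, zsum (fun n => nsq (d n)) N <= B) ->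
    forall N, zsum (fun n => nsq (A d n)) N <= r * B) ->
  l2 e -> (forall n, A e n = e n) -> forall n, e n = 0%C.
Proof.
  intros Hr HA He Hfix n.
  apply l2_iff_bounded in He. destruct He as [B HB].
  assert (Hk : forall k N, zsum (fun n => nsq (e n)) N <= B * r ^ k).
  { induction k as [|k IH]; intros N.
    - rewrite pow_O, Rmult_1_r. apply HB.
    - replace (B * r ^ S k) with (r * (B * r ^ k)) by (simpl; ring).
      eapply Rle_trans; [|apply (HA e _ IH N)].
      apply zsum_le. intros i. rewrite Hfix. lra. }
  apply nsq_eq0.
  destruct (zsum_ge_term (fun n => nsq (e n)) n) as [N HN]; [intros; apply nsq_ge0|].
  apply (is_lim_seq_le (fun _ => nsq (e n)) (fun k => B * r ^ k) (nsq (e n)) 0).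
  - intros k. eapply Rle_trans; [exact HN | apply Hk].
  - apply is_lim_seq_const.
  - replace (Finite 0) with (Finite (B * 0)) by (f_equal; ring).
    apply is_lim_seq_mult'; [apply is_lim_seq_const|].
    apply is_lim_seq_geom. rewrite Rabs_pos_eq; lra.
Qed.

Lemma coercive_not_in_spectrum V z s T c K L :
  0 < c -> 0 <= L ->
  (forall n, nsq (s n) = 1) ->
  (forall n, nsq (RtoC (V n) - z)%C <= K) ->
  coercive_with V z s T c -> boundary_bounded T L ->
  ~ in_spectrum V z.
Proof.
  intros Hc HL Hs HK Hco Hbd Hsp. apply Hsp. clear Hsp.
  destruct (richardson_contracts V z s T c K L Hc HL Hs HK Hco Hbd)
    as [tau [r [Htau [Hr HA]]]].
  assert (Hs0 : forall n, (RtoC tau * s n)%C <> 0%C).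
  { intros n E. assert (H : nsq (RtoC tau * s n)%C = 0) by (rewrite E; unfold nsq; simpl; ring).
    rewrite nsq_mult, Hs in H. unfold nsq in H. simpl in H. nra. }
  intros phi Hphi.
  set (A := richardson V z s tau) in *.
  set (d0 := fun n => (RtoC tau * (s n * phi n))%C).
  assert (Hd0 : exists b, 0 < b /\ forall N, zsum (fun n => nsq (d0 n)) N <= b ^ 2).
  { apply l2_iff_bounded in Hphi. destruct Hphi as [B HB].
    assert (HB0 : 0 <= B).
    { apply Rle_trans with (zsum (fun n => nsq (phi n)) 0); [|apply HB].
      rewrite zsum_0. pose proof (nsq_ge0 (phi 0%Z)); pose proof (nsq_ge0 (phi (-1)%Z)); lra. }
    exists (tau * (B + 1)). split; [nra|]. intros N.
    apply Rle_trans with (tau ^ 2 * zsum (fun n => nsq (phi n)) N).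
    - apply Req_le. transitivity (zsum (fun n => tau ^ 2 * nsq (phi n) + 0 * 0) N).
      + unfold zsum. f_equal; apply sum_n_ext; intros k; unfold d0;
          rewrite !nsq_mult, Hs; unfold nsq; simpl; ring.
      + rewrite (zsum_lin (fun n => nsq (phi n)) (fun _ => 0)). ring.
    - rewrite Rpow_mult_distr. apply Rmult_le_compat_l; [apply pow2_ge_0|].
      eapply Rle_trans; [apply HB|]. nra. }
  destruct Hd0 as [b [Hb Hd0]].
  set (q := (1 + r) / 2).
  assert (Hq : 0 < q < 1) by (unfold q; lra).
  assert (HA' : forall d B, (forall N, zsum (fun n => nsq (d n)) N <= B) ->
    forall N, zsum (fun n => nsq (A d n)) N <= q ^ 2 * B).
  { intros d B HB N. eapply Rle_trans; [apply HA; exact HB|].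
    apply Rmult_le_compat_r.
    - apply Rle_trans with (zsum (fun n => nsq (d n)) 0); [|apply HB].
      rewrite zsum_0. pose proof (nsq_ge0 (d 0%Z)); pose proof (nsq_ge0 (d (-1)%Z)); lra.
    - unfold q. pose proof (pow2_ge_0 (1 - r)). lra. }
  destruct (iterate_converges A d0 q b Hq Hb HA' Hd0) as [psi [Hpsi [L1 L2]]].
  exists psi. split; [exact Hpsi|].
  assert (Heq : forall n, shifted V z psi n = phi n).
  { intros n.
    set (dl := fun k => (shifted V z (iterate A d0 k) n - phi n)%C).
    assert (Hdl : forall k, tau ^ 2 * nsq (dl k) <= (b * q ^ S k) ^ 2).
    { intros k. replace (tau ^ 2 * nsq (dl k)) with (nsq (RtoC tau * (s n * dl k))%C)
        by (rewrite !nsq_mult, Hs; unfold nsq; simpl; ring).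
      replace (RtoC tau * (s n * dl k))%C with (- increment A d0 (S k) n)%C.
      - replace (nsq (- increment A d0 (S k) n)%C) with (nsq (increment A d0 (S k) n))
          by (unfold nsq; simpl; ring).
        apply (increment_pointwise A d0 q b HA' Hd0).
      - unfold dl.
        replace (RtoC tau * (s n * (shifted V z (iterate A d0 k) n - phi n)))%C
          with (RtoC tau * (s n * shifted V z (iterate A d0 k) n)
                - RtoC tau * (s n * phi n))%C by ring.
        pose proof (richardson_residual V z s tau phi k n) as Hres. cbv zeta in Hres.
        fold A d0 in Hres. rewrite Hres. ring. }
    enough (E : (shifted V z psi n - phi n)%C = 0%C).
    { replace (phi n) with (phi n + 0)%C by ring. rewrite <- E. ring. }
    apply nsq_eq0.
    assert (Hlim : is_lim_seq (fun k => nsq (dl k)) (nsq (shifted V z psi n - phi n)%C)).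
    { exact (is_lim_seq_shifted V z _ _ (phi n) n L1 L2). }
    apply Rmult_le_reg_l with (tau ^ 2); [apply pow_lt; lra|]. rewrite Rmult_0_r.
    apply (is_lim_seq_le (fun k => tau ^ 2 * nsq (dl k)) (fun k => (b * q ^ S k) ^ 2)
      (tau ^ 2 * nsq (shifted V z psi n - phi n)%C) 0); [exact Hdl| |].
    - apply is_lim_seq_mult'; [apply is_lim_seq_const | exact Hlim].
    - apply (is_lim_seq_incr_1 (fun k => (b * q ^ k) ^ 2)).
      replace (Finite 0) with (Finite (0 * (0 * 1))) by (f_equal; ring).
      pose proof (is_lim_seq_geom_bound q Hq b).
      apply is_lim_seq_mult'; [|apply is_lim_seq_mult']; auto. apply is_lim_seq_const. }
  split; [exact Heq|].
  intros psi' Hpsi' Heq'.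
  apply functional_extensionality. intros n.
  enough (E : (psi' n + - psi n)%C = 0%C).
  { replace (psi n) with (psi n + 0)%C by ring. rewrite <- E. ring. }
  refine (contraction_fixed_zero A r (fun n => psi' n + - psi n)%C Hr HA _ _ n).
  - apply l2_iff_bounded in Hpsi. apply l2_iff_bounded in Hpsi'. apply l2_iff_bounded.
    destruct Hpsi as [B HB], Hpsi' as [B' HB'].
    exists (2 * B' + 2 * B). intros N.
    apply Rle_trans with (zsum (fun n => 2 * nsq (psi' n) + 2 * nsq (psi n)) N).
    + apply zsum_le. intros i. destruct (psi' i), (psi i). unfold nsq; simpl.
      pose proof (pow2_ge_0 (r0 + r2)). pose proof (pow2_ge_0 (r1 + r3)). lra.
    + rewrite (zsum_lin (fun n => nsq (psi' n)) (fun n => nsq (psi n))).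
      specialize (HB N); specialize (HB' N). lra.
  - intros i. unfold A, richardson. rewrite shifted_plus.
    replace (shifted V z (fun k => - psi k)%C i) with (- shifted V z psi i)%C
      by (unfold shifted, Hop; ring).
    rewrite Heq. unfold shifted at 1. rewrite Heq'. ring.
Qed.

(** * The spectrum satisfies the discriminant condition *)

Lemma spectrum_real V K z :
  (forall n, Rabs (V n) <= K) -> in_spectrum V z -> snd z = 0.
Proof.
  intros HK Hsp. apply NNPP. intros Hz.
  assert (Hs : exists sg, sg * sg = 1 /\ 0 < sg * snd z).
  { destruct (Rtotal_order (snd z) 0) as [H|[H|H]]; [exists (-1)|easy|exists 1]; lra. }
  destruct Hs as [sg [Hsg Hpos]].
  revert Hsp.
  apply (coercive_not_in_spectrum V z (fun _ => (0, sg))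
    (fun d n => - sg * (fst (d (n - 1)%Z) * snd (d n) - snd (d (n - 1)%Z) * fst (d n)))
    (sg * snd z) ((K + Rabs (fst z)) ^ 2 + snd z ^ 2) 1); try lra.
  - intros n. unfold nsq; simpl. lra.
  - intros n. unfold nsq; simpl.
    assert (Rabs (V n + - fst z) <= K + Rabs (fst z)).
    { eapply Rle_trans; [apply Rabs_triang|]. rewrite Rabs_Ropp. specialize (HK n). lra. }
    apply Rabs_le_between in H. nra.
  - intros d n. replace (n + 1 - 1)%Z with n by lia.
    apply Req_le. unfold shifted, Hop, dot, nsq. simpl. ring.
  - intros d n. unfold nsq.
    generalize (d n) (d (n - 1)%Z). intros [a b] [a' b']. simpl.
    assert (Hsg' : sg = 1 \/ sg = -1).
    { assert (H : (sg - 1) * (sg + 1) = 0) by lra. apply Rmult_integral in H. lra. }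
    apply Rabs_le.
    pose proof (pow2_ge_0 (a - b')). pose proof (pow2_ge_0 (a + b')).
    pose proof (pow2_ge_0 (a' - b)). pose proof (pow2_ge_0 (a' + b)).
    destruct Hsg'; subst sg; lra.
Qed.

(* AM-GM: [4 <= kappa^2 u v] gives [2 F <= kappa (u X + v Y) / 2] whenever [F^2 <= X Y]. *)
Lemma cross_term_bound kappa u v d d' :
  0 < kappa -> 0 < u -> 0 < v -> 4 <= kappa ^ 2 * (u * v) ->
  2 * Rabs (dot d d') <= kappa / 2 * (u * nsq d + v * nsq d').
Proof.
  intros Hk Hu Hv H.
  assert (HF : dot d d' ^ 2 <= nsq d * nsq d').
  { destruct d as [a b], d' as [a' b']. unfold dot, nsq; simpl.
    pose proof (pow2_ge_0 (a * b' - b * a')). lra. }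
  pose proof (nsq_ge0 d) as HX. pose proof (nsq_ge0 d') as HY.
  set (X := nsq d) in *. set (Y := nsq d') in *. set (F := dot d d') in *.
  replace (2 * Rabs F) with (Rabs (2 * F)) by (rewrite Rabs_mult, (Rabs_pos_eq 2); lra).
  assert (0 <= u * X) by nra. assert (0 <= v * Y) by nra.
  apply Rsqr_incr_0_var; [|apply Rmult_le_pos; lra].
  rewrite <- Rsqr_abs. unfold Rsqr.
  assert (H2 : 0 <= (kappa / 2) ^ 2 * (u * X - v * Y) ^ 2)
    by (apply Rmult_le_pos; apply pow2_ge_0).
  assert (H3 : 4 * (X * Y) <= kappa ^ 2 * (u * v) * (X * Y))
    by (apply Rmult_le_compat_r; [apply Rmult_le_pos; lra | lra]).
  lra.
Qed.

(* The multiplier is minus the sign of [u]: at a sign change of [u] the hopping terms cancel. *)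
Lemma signed_not_in_spectrum V E delta eta K :
  0 < delta -> 0 < eta < 1 ->
  (forall n, delta <= Rabs (E - V n) <= K) ->
  (forall n, (E - V n) * (E - V (n + 1)%Z) < 0 \/
     4 <= (1 - eta) ^ 2 * ((E - V n) * (E - V (n + 1)%Z))) ->
  ~ in_spectrum V (RtoC E).
Proof.
  intros Hd He HK Hpair.
  set (u := fun n => E - V n).
  set (sg := fun n => if Rlt_dec 0 (u n) then 1 else -1).
  assert (Hsg : forall n, sg n * u n = Rabs (u n) /\ (sg n = 1 \/ sg n = -1)).
  { intros n. unfold sg. destruct (Rlt_dec 0 (u n)).
    - rewrite Rabs_pos_eq by lra. lra.
    - rewrite Rabs_left1 by lra. lra. }
  apply (coercive_not_in_spectrum V (RtoC E) (fun n => RtoC (- sg n))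
    (fun d n => sg n * dot (d (n - 1)%Z) (d n)
                - (1 - eta) / 2 * (Rabs (u n) * nsq (d n)))
    (eta * delta) (K ^ 2) (1 + K)).
  - apply Rmult_lt_0_compat; lra.
  - pose proof (HK 0%Z). pose proof (Rabs_pos (E - V 0%Z)). lra.
  - intros n. unfold nsq; simpl. destruct (Hsg n) as [_ [->| ->]]; lra.
  - intros n. unfold nsq; simpl. destruct (HK n) as [_ H].
    apply Rabs_le_between in H. nra.
  - intros d n. replace (n + 1 - 1)%Z with n by lia.
    assert (Hcross : (sg n + sg (n + 1)%Z) * dot (d n) (d (n + 1)%Z)
      <= (1 - eta) / 2 * (Rabs (u n) * nsq (d n) + Rabs (u (n + 1)%Z) * nsq (d (n + 1)%Z))).
    { assert (Hpos : 0 <= (1 - eta) / 2 *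
        (Rabs (u n) * nsq (d n) + Rabs (u (n + 1)%Z) * nsq (d (n + 1)%Z))).
      { pose proof (nsq_ge0 (d n)). pose proof (nsq_ge0 (d (n + 1)%Z)).
        pose proof (Rabs_pos (u n)). pose proof (Rabs_pos (u (n + 1)%Z)).
        apply Rmult_le_pos; [lra|]. apply Rplus_le_le_0_compat; now apply Rmult_le_pos. }
      destruct (Hsg n) as [H1 S1], (Hsg (n + 1)%Z) as [H2 S2].
      destruct (HK n) as [D1 _], (HK (n + 1)%Z) as [D2 _]. fold (u n) in D1. fold (u (n + 1)%Z) in D2.
      destruct (Req_dec (sg n) (sg (n + 1)%Z)) as [Heq|Hne].
      - destruct (Hpair n) as [Hp|Hp]; fold (u n) (u (n + 1)%Z) in Hp.
        { exfalso. rewrite <- Heq in H2.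
          assert (0 < (sg n * u n) * (sg n * u (n + 1)%Z))
            by (rewrite H1, H2; apply Rmult_lt_0_compat; lra).
          destruct S1 as [E1|E1]; rewrite E1 in *; lra. }
        assert (Hc := cross_term_bound (1 - eta) (Rabs (u n)) (Rabs (u (n + 1)%Z))
          (d n) (d (n + 1)%Z)).
        assert (HP : 0 < u n * u (n + 1)%Z)
          by (apply Rmult_lt_reg_l with ((1 - eta) ^ 2); [apply pow_lt|]; lra).
        rewrite <- Rabs_mult, (Rabs_pos_eq (u n * u (n + 1)%Z)) in Hc by lra.
        specialize (Hc ltac:(lra) ltac:(lra) ltac:(lra) Hp).
        pose proof (Rle_abs (dot (d n) (d (n + 1)%Z))).
        pose proof (Rle_abs (- dot (d n) (d (n + 1)%Z))) as Hn. rewrite Rabs_Ropp in Hn.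
        rewrite <- Heq. destruct S1 as [E1|E1]; rewrite E1; lra.
      - replace (sg n + sg (n + 1)%Z) with 0 by lra. lra. }
    assert (E1 : dot (d n) (RtoC (- sg n) * shifted V (RtoC E) d n)%C
      = Rabs (u n) * nsq (d n) - sg n * dot (d n) (d (n + 1)%Z)
        - sg n * dot (d (n - 1)%Z) (d n)).
    { rewrite <- (proj1 (Hsg n)). unfold u, shifted, Hop, dot, nsq. simpl. ring. }
    rewrite E1.
    assert (delta * nsq (d n) <= Rabs (u n) * nsq (d n)).
    { apply Rmult_le_compat_r; [apply nsq_ge0|]. apply HK. }
    assert (eta * (delta * nsq (d n)) <= eta * (Rabs (u n) * nsq (d n)))
      by (apply Rmult_le_compat_l; lra).
    lra.
  - intros d n.
    assert (Hdot : Rabs (dot (d (n - 1)%Z) (d n)) <= nsq (d n) + nsq (d (n - 1)%Z)).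
    { destruct (d n) as [a b], (d (n - 1)%Z) as [a' b']. unfold dot, nsq; simpl.
      pose proof (pow2_ge_0 (a - a')). pose proof (pow2_ge_0 (a + a')).
      pose proof (pow2_ge_0 (b - b')). pose proof (pow2_ge_0 (b + b')).
      apply Rabs_le. nra. }
    apply Rabs_le_between in Hdot.
    pose proof (nsq_ge0 (d n)). pose proof (nsq_ge0 (d (n - 1)%Z)).
    destruct (HK n) as [D1 D2]. fold (u n) in D1, D2.
    assert (0 <= Rabs (u n) * nsq (d n)) by (apply Rmult_le_pos; lra).
    assert (Rabs (u n) * nsq (d n) <= K * nsq (d n)) by (apply Rmult_le_compat_r; lra).
    assert (0 <= K * nsq (d (n - 1)%Z)) by (apply Rmult_le_pos; lra).
    assert ((1 - eta) / 2 * (Rabs (u n) * nsq (d n)) <= 1 * (Rabs (u n) * nsq (d n)))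
      by (apply Rmult_le_compat_r; lra).
    assert (0 <= (1 - eta) / 2 * (Rabs (u n) * nsq (d n))) by (apply Rmult_le_pos; lra).
    apply Rabs_le. destruct (Hsg n) as [_ [->| ->]]; lra.
Qed.

Lemma uniform_pos (m : nat) (Q : nat -> R -> Prop) :
  (forall a x y, 0 < y <= x -> Q a x -> Q a y) ->
  (forall a, (1 <= a <= m)%nat -> exists x, 0 < x /\ Q a x) ->
  exists x, 0 < x /\ forall a, (1 <= a <= m)%nat -> Q a x.
Proof.
  intros Hmono. induction m as [|m IH]; intros HQ.
  - exists 1. split; [lra|]. intros; lia.
  - destruct IH as [x [Hx H]].
    { intros a Ha. apply HQ. lia. }
    destruct (HQ (S m)) as [y [Hy H']]; [lia|].
    exists (Rmin x y). split; [now apply Rmin_glb_lt|].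
    pose proof (Rmin_l x y). pose proof (Rmin_r x y).
    assert (0 < Rmin x y) by now apply Rmin_glb_lt.
    intros a Ha. destruct (Nat.eq_dec a (S m)) as [->|].
    + apply (Hmono _ y); [lra|easy].
    + apply (Hmono _ x); [lra|]. apply H. lia.
Qed.

Lemma uniform_bound (m : nat) (f : nat -> R) :
  exists K, forall a, (1 <= a <= m)%nat -> Rabs (f a) <= K.
Proof.
  induction m as [|m [K H]].
  - exists 0. intros; lia.
  - exists (Rmax K (Rabs (f (S m)))). intros a Ha.
    destruct (Nat.eq_dec a (S m)) as [->|]; [apply Rmax_r|].
    eapply Rle_trans; [apply H; lia | apply Rmax_l].
Qed.

Lemma Vpot_eq g w n : Vpot g w n = g (fst w n) ((snd w + n) mod 2)%Z.
Proof. reflexivity. Qed.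

Lemma Vpot_bounded m g w : in_X m w -> exists K, forall n, Rabs (Vpot g w n) <= K.
Proof.
  intros [Hx _].
  destruct (uniform_bound m (fun a => g a 0%Z)) as [K0 H0].
  destruct (uniform_bound m (fun a => g a 1%Z)) as [K1 H1].
  exists (Rmax K0 K1). intros n. rewrite Vpot_eq.
  assert (Hm : ((snd w + n) mod 2 = 0 \/ (snd w + n) mod 2 = 1)%Z)
    by (pose proof (Z.mod_pos_bound (snd w + n) 2); lia).
  destruct Hm as [-> | ->].
  - eapply Rle_trans; [apply H0, Hx | apply Rmax_l].
  - eapply Rle_trans; [apply H1, Hx | apply Rmax_r].
Qed.

Lemma spectrum_discriminant m g w z : in_X m w -> in_spectrum (Vpot g w) z ->
  exists E a b, z = RtoC E /\ (1 <= a <= m)%nat /\ (1 <= b <= m)%nat /\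
    0 <= (E - g a 0%Z) * (E - g b 1%Z) <= 4.
Proof.
  intros Hw Hsp. destruct (Vpot_bounded m g w Hw) as [K HK].
  pose proof (spectrum_real _ K z HK Hsp) as Hz.
  destruct z as [E y]. simpl in Hz. subst y. exists E.
  apply NNPP. intros Hno. change (E, 0) with (RtoC E) in *.
  assert (Hgap : forall a b, (1 <= a <= m)%nat -> (1 <= b <= m)%nat ->
    (E - g a 0%Z) * (E - g b 1%Z) < 0 \/ 4 < (E - g a 0%Z) * (E - g b 1%Z)).
  { intros a b Ha Hb. apply NNPP. intros H. apply Hno. exists a, b.
    repeat split; try easy; lra. }
  clear Hno.
  set (Q := fun a b x => (E - g a 0%Z) * (E - g b 1%Z) < 0 \/
    (x < 1 /\ 4 <= (1 - x) ^ 2 * ((E - g a 0%Z) * (E - g b 1%Z)))).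
  assert (HQm : forall a b x y, 0 < y <= x -> Q a b x -> Q a b y).
  { intros a b x y Hxy [H|[H1 H2]]; [now left|right]. split; [lra|].
    eapply Rle_trans; [exact H2|]. apply Rmult_le_compat_r.
    - assert (0 < (1 - x) ^ 2) by (apply pow_lt; lra). nra.
    - apply pow_incr. lra. }
  destruct (uniform_pos m (fun a x => forall b, (1 <= b <= m)%nat -> Q a b x))
    as [eta0 [Heta0 HQ]].
  { intros a x y Hxy H b Hb. apply (HQm a b x y Hxy). now apply H. }
  { intros a Ha. apply uniform_pos; [apply HQm|].
    intros b Hb. destruct (Hgap a b Ha Hb) as [H|H].
    - exists 1. split; [lra|now left].
    - set (P := (E - g a 0%Z) * (E - g b 1%Z)) in *.
      exists ((P - 4) / (2 * P)).
      assert (0 < (P - 4) / (2 * P)) by (apply Rdiv_lt_0_compat; lra).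
      split; [easy|]. right. fold P. split.
      + apply Rmult_lt_reg_r with (2 * P); [lra|].
        replace ((P - 4) / (2 * P) * (2 * P)) with (P - 4) by (field; lra). lra.
      + assert (((P - 4) / (2 * P)) * P * 2 = P - 4) by (field; lra).
        set (x := (P - 4) / (2 * P)) in *. pose proof (pow2_ge_0 x).
        assert (0 <= x ^ 2 * P) by (apply Rmult_le_pos; lra). lra. }
  assert (Hne : forall n, exists a b, (1 <= a <= m)%nat /\ (1 <= b <= m)%nat /\
    (Vpot g w n = g a 0%Z /\ Vpot g w (n + 1)%Z = g b 1%Z \/
     Vpot g w n = g b 1%Z /\ Vpot g w (n + 1)%Z = g a 0%Z)).
  { intros n. destruct Hw as [Hx _]. rewrite !Vpot_eq.
    destruct (Z.eq_dec ((snd w + n) mod 2) 0) as [H0|H0].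
    - assert (H1 : ((snd w + (n + 1)) mod 2 = 1)%Z).
      { pose proof (Z.div_mod (snd w + n) 2). symmetry.
        apply Z.mod_unique with ((snd w + n) / 2)%Z; lia. }
      exists (fst w n), (fst w (n + 1)%Z). rewrite H0, H1. auto.
    - assert (H0' : ((snd w + n) mod 2 = 1)%Z)
        by (pose proof (Z.mod_pos_bound (snd w + n) 2); lia).
      assert (H1 : ((snd w + (n + 1)) mod 2 = 0)%Z).
      { pose proof (Z.div_mod (snd w + n) 2). symmetry.
        apply Z.mod_unique with ((snd w + n) / 2 + 1)%Z; lia. }
      exists (fst w (n + 1)%Z), (fst w n). rewrite H0', H1. auto. }
  destruct (uniform_pos m (fun a x => x <= Rabs (E - g a 0%Z) /\ x <= Rabs (E - g a 1%Z)))
    as [delta [Hdelta HD]].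
  { intros a x y Hxy H. lra. }
  { intros a Ha. exists (Rmin (Rabs (E - g a 0%Z)) (Rabs (E - g a 1%Z))).
    split; [|split; [apply Rmin_l | apply Rmin_r]].
    apply Rmin_glb_lt; apply Rabs_pos_lt; intros H0;
      specialize (Hgap a a Ha Ha); rewrite H0 in Hgap; lra. }
  revert Hsp.
  apply (signed_not_in_spectrum _ E delta (Rmin eta0 (1 / 2)) (Rabs E + K)); [easy| | |].
  - pose proof (Rmin_r eta0 (1 / 2)). split; [apply Rmin_glb_lt; lra | lra].
  - intros n. split.
    + destruct (Hne n) as [a [b [Ha [Hb [[-> _]|[-> _]]]]]]; now apply HD.
    + eapply Rle_trans; [apply Rabs_triang|]. rewrite Rabs_Ropp. specialize (HK n). lra.
  - assert (Hmin : 0 < Rmin eta0 (1 / 2) <= eta0)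
      by (split; [apply Rmin_glb_lt; lra | apply Rmin_l]).
    intros n. destruct (Hne n) as [a [b [Ha [Hb Hab]]]].
    pose proof (HQm a b _ _ Hmin (HQ a Ha b Hb)) as HQ'. unfold Q in HQ'.
    destruct Hab as [[-> ->]|[-> ->]]; [tauto|].
    rewrite (Rmult_comm (E - g b 1%Z)). tauto.
Qed.

(** * Long periodic blocks *)

Fixpoint bloch (w x y : C) (n : nat) : C :=
  match n with
  | O => x
  | S O => y
  | S (S n) => (w * bloch w x y n)%C
  end.

Lemma nat_ind2 (P : nat -> Prop) :
  P 0%nat -> P 1%nat -> (forall n, P n -> P (S (S n))) -> forall n, P n.
Proof.
  intros H0 H1 H n. enough (P n /\ P (S n)) by tauto.
  induction n as [|n [IH1 IH2]]; auto.
Qed.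

(* The multiplier [w] is the point of the unit circle with [alpha beta = 2 + 2 Re w]. *)
Lemma bloch_wave_exists alpha beta : 0 <= alpha * beta <= 4 ->
  exists (u : nat -> C) (rho : R), 0 < rho /\
    (forall n, (u (S (S n)) + u n = RtoC (if Nat.even n then beta else alpha) * u (S n))%C) /\
    (forall n, nsq (u n) + nsq (u (S n)) = rho).
Proof.
  intros Hab.
  set (c := alpha * beta / 2 - 1). set (s := sqrt (1 - c * c)).
  assert (Hc : 0 <= 1 - c * c) by (unfold c; nra).
  assert (Hs : s * s = 1 - c * c) by now apply sqrt_sqrt.
  assert (Hw : nsq (c, s) = 1) by (unfold nsq; simpl; lra).
  assert (Hxy : exists x y, 0 < nsq x + nsq y /\
    (((c, s) : C) * x + x = RtoC beta * y)%C /\ (((c, s) : C) * y + y = RtoC alpha * (((c, s) : C) * x))%C).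
  { destruct (Req_dec alpha 0) as [Ha|Ha].
    - exists (RtoC 1), (RtoC 0). split; [unfold nsq; simpl; lra|].
      assert (Hc1 : c = -1) by (unfold c; rewrite Ha; lra).
      assert (Hs0 : s = 0) by (rewrite Hc1 in Hs; nra).
      rewrite Ha, Hc1, Hs0.
      split; apply injective_projections; simpl; ring.
    - exists ((1 + c, - s) : C), (RtoC alpha). split.
      + unfold nsq; simpl. assert (0 < alpha * alpha) by nra. nra.
      + assert (alpha * beta = 2 + 2 * c) by (unfold c; field).
        split; apply injective_projections; simpl; nra. }
  destruct Hxy as [x [y [Hpos [E0 E1]]]].
  set (w := ((c, s) : C)) in *.
  exists (bloch w x y), (nsq x + nsq y). split; [exact Hpos|]. split.
  - intros n. induction n as [| |n IH] using nat_ind2.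
    + exact E0.
    + exact E1.
    + change (bloch w x y (S (S (S (S n))))) with (w * bloch w x y (S (S n)))%C.
      change (bloch w x y (S (S (S n)))) with (w * bloch w x y (S n))%C.
      change (bloch w x y (S (S n))) with (w * bloch w x y n)%C at 2.
      change (Nat.even (S (S n))) with (Nat.even n).
      replace (w * bloch w x y (S (S n)) + w * bloch w x y n)%C
        with (w * (bloch w x y (S (S n)) + bloch w x y n))%C by ring.
      rewrite IH. ring.
  - intros n. induction n as [|n IH].
    + reflexivity.
    + change (bloch w x y (S (S n))) with (w * bloch w x y n)%C.
      rewrite nsq_mult, Hw, <- IH. ring.
Qed.

Lemma green_identity V E (psi : Z -> C) (u : nat -> C) s k :
  (forall i, (s < i <= s + S k)%nat ->
    (u (S i) + u (i - 1)%nat = RtoC (E - V (Z.of_nat i)) * u i)%C) ->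
  sum_n (fun i => dot (shifted V (RtoC E) psi (Z.of_nat (s + S i))) (u (s + S i)%nat)) k
  = (dot (psi (Z.of_nat (s + S k) + 1)%Z) (u (s + S k)%nat)
     - dot (psi (Z.of_nat (s + S k))) (u (S (s + S k))))
    - (dot (psi (Z.of_nat s + 1)%Z) (u s) - dot (psi (Z.of_nat s)) (u (S s))).
Proof.
  assert (Hstep : forall n : nat, (u (S (S n)) + u n = RtoC (E - V (Z.of_nat (S n))) * u (S n))%C ->
    dot (shifted V (RtoC E) psi (Z.of_nat (S n))) (u (S n))
    = (dot (psi (Z.of_nat (S n) + 1)%Z) (u (S n)) - dot (psi (Z.of_nat (S n))) (u (S (S n))))
      - (dot (psi (Z.of_nat n + 1)%Z) (u n) - dot (psi (Z.of_nat n)) (u (S n)))).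
  { intros n H.
    replace (u (S (S n))) with (RtoC (E - V (Z.of_nat (S n))) * u (S n) - u n)%C
      by (rewrite <- H; ring).
    unfold shifted, Hop.
    replace (Z.of_nat (S n) - 1)%Z with (Z.of_nat n) by lia.
    replace (Z.of_nat n + 1)%Z with (Z.of_nat (S n)) by lia.
    unfold dot; simpl; ring. }
  intros Hu. induction k as [|k IH].
  - rewrite sum_n_0. replace (s + 1)%nat with (S s) by lia. apply Hstep.
    specialize (Hu (S s) ltac:(lia)). now replace (S s - 1)%nat with s in Hu by lia.
  - rewrite sum_n_S, IH by (intros; apply Hu; lia).
    replace (s + S (S k))%nat with (S (s + S k)) by lia.
    specialize (Hu (S (s + S k)) ltac:(lia)).
    replace (S (s + S k) - 1)%nat with (s + S k)%nat in Hu by lia.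
    rewrite (Hstep _ Hu). lra.
Qed.

Lemma sum_n_le (f g : nat -> R) N : (forall n, f n <= g n) -> sum_n f N <= sum_n g N.
Proof.
  intros H. induction N as [|N IH].
  - rewrite !sum_n_0. apply H.
  - rewrite !sum_n_S. specialize (H (S N)). lra.
Qed.

Lemma sum_n_pairs (f : nat -> R) rho k :
  (forall n, f n + f (S n) = rho) -> sum_n f (2 * k + 1) = INR (S k) * rho.
Proof.
  intros H. induction k as [|k IH].
  - change (2 * 0 + 1)%nat with 1%nat. rewrite sum_n_S, sum_n_0, H. simpl; lra.
  - replace (2 * S k + 1)%nat with (S (S (2 * k + 1))) by lia.
    rewrite !sum_n_S, IH, Rplus_assoc, H, (S_INR (S k)). lra.
Qed.

Definition in_block (s l n : nat) : R :=
  if andb (Nat.leb s n) (Nat.ltb n (s + l)) then 1 else 0.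

Lemma in_block_bounds s l n : 0 <= in_block s l n <= 1.
Proof. unfold in_block. destruct (_ && _)%bool; lra. Qed.

Lemma in_block_in s l n : (s <= n < s + l)%nat -> in_block s l n = 1.
Proof.
  intros H. unfold in_block.
  destruct (Nat.leb_spec s n), (Nat.ltb_spec n (s + l)); simpl; try lia; reflexivity.
Qed.

Lemma sum_in_block s l N : sum_n (in_block s l) N <= INR l.
Proof.
  enough (H : sum_n (in_block s l) N <= INR (Nat.min l (S N - s))).
  { eapply Rle_trans; [exact H|]. apply le_INR. lia. }
  induction N as [|N IH].
  - rewrite sum_n_0. unfold in_block.
    destruct (Nat.leb_spec s 0), (Nat.ltb_spec 0 (s + l)); simpl andb; cbv iota;
      try apply pos_INR.
    replace (Nat.min l (1 - s)) with 1%nat by lia. simpl; lra.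
  - rewrite sum_n_S. unfold in_block at 2.
    destruct (Nat.leb_spec s (S N)), (Nat.ltb_spec (S N) (s + l)); simpl andb; cbv iota.
    + replace (Nat.min l (S (S N) - s)) with (S (Nat.min l (S N - s))) by lia.
      rewrite S_INR. lra.
    + assert (INR (Nat.min l (S N - s)) <= INR (Nat.min l (S (S N) - s)))
        by (apply le_INR; lia). lra.
    + assert (INR (Nat.min l (S N - s)) <= INR (Nat.min l (S (S N) - s)))
        by (apply le_INR; lia). lra.
    + assert (INR (Nat.min l (S N - s)) <= INR (Nat.min l (S (S N) - s)))
        by (apply le_INR; lia). lra.
Qed.

(* The k-th block contributes about [4^-k] to the square norm, but [2^k] to the sum of [a]. *)
Lemma block_weight (s : nat -> nat) : (forall k, (k <= s k)%nat) ->
  exists a : nat -> R, (forall n, 0 <= a n) /\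
    (forall k n, (s k <= n < s k + (2 * 16 ^ k + 2))%nat -> / 8 ^ k <= a n) /\
    (exists B, forall N, sum_n (fun n => a n ^ 2) N <= B).
Proof.
  intros Hs.
  set (t := fun n k => (/ 8 ^ k) ^ 2 * in_block (s k) (2 * 16 ^ k + 2) n).
  assert (Ht : forall n k, 0 <= t n k).
  { intros n k. apply Rmult_le_pos; [apply pow2_ge_0 | apply in_block_bounds]. }
  assert (Hsum : forall n k, 0 <= sum_n (t n) k).
  { intros n k. induction k as [|k IH]; [rewrite sum_n_0 | rewrite sum_n_S; specialize (Ht n (S k))];
      auto; lra. }
  assert (Hterm : forall n k j, (j <= k)%nat -> t n j <= sum_n (t n) k).
  { intros n k j H. induction H as [|k H IH].
    - destruct j; [rewrite sum_n_0; lra|]. rewrite sum_n_S. specialize (Hsum n j). lra.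
    - rewrite sum_n_S. specialize (Ht n (S k)). lra. }
  exists (fun n => sqrt (sum_n (t n) n)). split; [intros; apply sqrt_pos|]. split.
  - intros k n Hn.
    assert (0 < / 8 ^ k) by (apply Rinv_0_lt_compat, pow_lt; lra).
    rewrite <- (sqrt_pow2 (/ 8 ^ k)) by lra. apply sqrt_le_1_alt.
    eapply Rle_trans; [|apply (Hterm n n k); specialize (Hs k); lia].
    unfold t. rewrite in_block_in by exact Hn. lra.
  - exists 8. intros N.
    apply Rle_trans with (sum_n (fun n => sum_n (t n) N) N).
    { enough (H : forall M, (M <= N)%nat ->
        sum_n (fun n => sqrt (sum_n (t n) n) ^ 2) M <= sum_n (fun n => sum_n (t n) N) M)
        by (apply H; lia).
      assert (Hmono : forall n, (n <= N)%nat -> sum_n (t n) n <= sum_n (t n) N).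
      { intros n H. induction H as [|k H IH]; [lra|]. rewrite sum_n_S. specialize (Ht n (S k)). lra. }
      induction M as [|M IH]; intros HM.
      - rewrite (sum_n_0 (fun n => sqrt (sum_n (t n) n) ^ 2)), (sum_n_0 (fun n => sum_n (t n) N)).
        rewrite pow2_sqrt by auto. apply Hmono; lia.
      - rewrite (sum_n_S (fun n => sqrt (sum_n (t n) n) ^ 2)), (sum_n_S (fun n => sum_n (t n) N)).
        rewrite pow2_sqrt by auto. specialize (IH ltac:(lia)). specialize (Hmono (S M) HM). lra. }
    rewrite sum_n_switch.
    apply Rle_trans with (sum_n (fun k => 4 * (/ 4) ^ k) N).
    { apply sum_n_le. intros k. unfold t.
      apply Rle_trans with ((/ 8 ^ k) ^ 2 * INR (2 * 16 ^ k + 2)).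
      { apply Rle_trans with ((/ 8 ^ k) ^ 2 * sum_n (in_block (s k) (2 * 16 ^ k + 2)) N).
        - apply Req_le. apply (sum_n_mult_l (K := R_AbsRing) ((/ 8 ^ k) ^ 2)).
        - apply Rmult_le_compat_l; [apply pow2_ge_0 | apply sum_in_block]. }
      rewrite plus_INR, mult_INR, pow_INR. simpl (INR 2). replace (INR 16) with 16 by (simpl; ring).
      assert (H16 : 1 <= 16 ^ k) by (apply pow_R1_Rle; lra).
      assert (H8 : (/ 8 ^ k) ^ 2 * 16 ^ k = (/ 4) ^ k).
      { rewrite <- pow_inv, <- pow_mult, Nat.mul_comm, pow_mult, <- Rpow_mult_distr. f_equal. field. }
      pose proof (pow2_ge_0 (/ 8 ^ k)).
      replace (4 * (/ 4) ^ k) with ((/ 8 ^ k) ^ 2 * (4 * 16 ^ k)) by (rewrite <- H8; ring).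
      apply Rmult_le_compat_l; lra. }
    enough (sum_n (fun k => 4 * (/ 4) ^ k) N = 16 / 3 * (1 - (/ 4) ^ S N)).
    { rewrite H. assert (0 < (/ 4) ^ S N) by (apply pow_lt; lra). lra. }
    clear. induction N as [|N IH].
    + rewrite sum_n_0. simpl. field.
    + rewrite sum_n_S, IH. simpl. field.
Qed.

Lemma long_blocks_in_spectrum V E alpha beta :
  0 <= (E - alpha) * (E - beta) <= 4 ->
  (forall l, exists s, forall n, (s <= n < s + l)%nat ->
     V (Z.of_nat n) = if Nat.even n then alpha else beta) ->
  in_spectrum V (RtoC E).
Proof.
  intros Hab Hblocks Hbij.
  destruct (bloch_wave_exists (E - alpha) (E - beta) Hab) as [u [rho [Hrho [Hu Hnorm]]]].
  assert (Hub : forall n, 0 <= nsq (u n) <= rho).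
  { intros n. rewrite <- (Hnorm n). pose proof (nsq_ge0 (u n)). pose proof (nsq_ge0 (u (S n))). lra. }
  assert (Hfar : forall k, exists s, (k <= s)%nat /\
    forall n, (s <= n < s + (2 * 16 ^ k + 2))%nat ->
      V (Z.of_nat n) = if Nat.even n then alpha else beta).
  { intros k. destruct (Hblocks (k + (2 * 16 ^ k + 2))%nat) as [s Hs].
    exists (s + k)%nat. split; [lia|]. intros n Hn. apply Hs. lia. }
  set (s := fun k => proj1_sig (constructive_indefinite_description _ (Hfar k))).
  assert (Hs : forall k, (k <= s k)%nat /\
    forall n, (s k <= n < s k + (2 * 16 ^ k + 2))%nat ->
      V (Z.of_nat n) = if Nat.even n then alpha else beta).
  { intros k. unfold s. apply proj2_sig. }
  clearbody s. clear Hfar Hblocks.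
  destruct (block_weight s (fun k => proj1 (Hs k))) as [a [Ha0 [Ha [B HB]]]].
  set (phi := fun n : Z => if Z_lt_dec n 0 then RtoC 0
                           else (RtoC (a (Z.to_nat n)) * u (Z.to_nat n))%C).
  assert (Hphi : forall n : nat, phi (Z.of_nat n) = (RtoC (a n) * u n)%C).
  { intros n. unfold phi. destruct (Z_lt_dec (Z.of_nat n) 0); [lia|].
    now rewrite Nat2Z.id. }
  assert (Hphineg : forall n : nat, phi (- Z.of_nat (S n))%Z = RtoC 0).
  { intros n. unfold phi. destruct (Z_lt_dec (- Z.of_nat (S n)) 0); [easy|lia]. }
  destruct (Hbij phi) as [psi [Hpsi [Heq _]]].
  { apply l2_iff_bounded. exists (rho * B). intros N. unfold zsum.
    apply Rle_trans with (sum_n (fun k => rho * a k ^ 2) N + sum_n (fun _ => 0) N).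
    - apply Rplus_le_compat; apply sum_n_le; intros n.
      + rewrite Hphi, nsq_mult.
        replace (nsq (RtoC (a n))) with (a n ^ 2) by (unfold nsq; simpl; ring).
        rewrite (Rmult_comm rho). apply Rmult_le_compat_l; [apply pow2_ge_0 | apply Hub].
      + rewrite Hphineg. unfold nsq; simpl; lra.
    - rewrite sum_n_const, Rmult_0_r, Rplus_0_r.
      apply Rle_trans with (rho * sum_n (fun k => a k ^ 2) N).
      + apply Req_le. apply (sum_n_mult_l (K := R_AbsRing) rho).
      + apply Rmult_le_compat_l; [lra | apply HB]. }
  apply l2_iff_bounded in Hpsi. destruct Hpsi as [P HP].
  assert (Hpb : forall n, nsq (psi n) <= P).
  { intros n. destruct (zsum_ge_term (fun n => nsq (psi n)) n) as [N HN]; [intros; apply nsq_ge0|].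
    eapply Rle_trans; [exact HN | apply HP]. }
  assert (Hdot : forall n m, Rabs (dot (psi n) (u m)) <= P + rho).
  { intros n m. pose proof (Hpb n) as H1. pose proof (Hub m) as [_ H2].
    destruct (psi n) as [x1 y1], (u m) as [x2 y2]. unfold nsq, dot in *; simpl in *.
    pose proof (pow2_ge_0 (x1 - x2)). pose proof (pow2_ge_0 (x1 + x2)).
    pose proof (pow2_ge_0 (y1 - y2)). pose proof (pow2_ge_0 (y1 + y2)).
    pose proof (pow2_ge_0 x1). pose proof (pow2_ge_0 y1).
    pose proof (pow2_ge_0 x2). pose proof (pow2_ge_0 y2).
    apply Rabs_le. lra. }
  assert (Hk : forall k, 2 ^ k * rho <= 4 * (P + rho)).
  { intros k.
    assert (Hpos : (0 < 16 ^ k)%nat) by (apply Nat.neq_0_lt_0, Nat.pow_nonzero; lia).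
    set (K := (2 * (16 ^ k - 1) + 1)%nat).
    assert (HK : (S (S K) <= 2 * 16 ^ k + 2)%nat) by (unfold K; lia).
    assert (Hlow : / 8 ^ k * (INR (16 ^ k) * rho) <=
      sum_n (fun i => dot (shifted V (RtoC E) psi (Z.of_nat (s k + S i))) (u (s k + S i)%nat)) K).
    { replace (16 ^ k)%nat with (S (16 ^ k - 1)) at 1 by lia.
      rewrite <- (sum_n_pairs (fun i => nsq (u (s k + S i)%nat))).
      2: { intros n. rewrite <- (Hnorm (s k + S n)%nat). do 3 f_equal. lia. }
      fold K.
      assert (HKK : forall M, (M <= K)%nat ->
        / 8 ^ k * sum_n (fun i => nsq (u (s k + S i)%nat)) M <=
        sum_n (fun i => dot (shifted V (RtoC E) psi (Z.of_nat (s k + S i))) (u (s k + S i)%nat)) M).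
      2: { apply HKK; lia. }
      assert (Hterm : forall i, (i <= K)%nat -> / 8 ^ k * nsq (u (s k + S i)%nat) <=
        dot (shifted V (RtoC E) psi (Z.of_nat (s k + S i))) (u (s k + S i)%nat)).
      { intros i Hi. unfold shifted. rewrite Heq, Hphi.
        replace (dot (RtoC (a (s k + S i)%nat) * u (s k + S i)%nat)%C (u (s k + S i)%nat))
          with (a (s k + S i)%nat * nsq (u (s k + S i)%nat))
          by (unfold dot, nsq; simpl; ring).
        apply Rmult_le_compat_r; [apply nsq_ge0|]. apply Ha. lia. }
      induction M as [|M IH]; intros HM.
      - rewrite !sum_n_0. apply Hterm; lia.
      - rewrite !sum_n_S, Rmult_plus_distr_l. apply Rplus_le_compat; [apply IH; lia|].
        apply Hterm; lia. }
    rewrite green_identity in Hlow.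
    - rewrite pow_INR in Hlow. replace (INR 16) with (8 * 2) in Hlow by (simpl; ring).
      rewrite Rpow_mult_distr in Hlow.
      replace (/ 8 ^ k * (8 ^ k * 2 ^ k * rho)) with (2 ^ k * rho) in Hlow
        by (field; apply pow_nonzero; lra).
      pose proof (Hdot (Z.of_nat (s k + S K) + 1)%Z (s k + S K)%nat) as D1.
      pose proof (Hdot (Z.of_nat (s k + S K)) (S (s k + S K))) as D2.
      pose proof (Hdot (Z.of_nat (s k) + 1)%Z (s k)) as D3.
      pose proof (Hdot (Z.of_nat (s k)) (S (s k))) as D4.
      apply Rabs_le_between in D1. apply Rabs_le_between in D2.
      apply Rabs_le_between in D3. apply Rabs_le_between in D4. lra.
    - intros i Hi. destruct i as [|i]; [lia|].
      replace (S i - 1)%nat with i by lia. rewrite Hu.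
      rewrite (proj2 (Hs k)) by lia. rewrite Nat.even_succ, <- Nat.negb_even.
      destruct (Nat.even i); reflexivity. }
  destruct (Pow_x_infinity 2 ltac:(rewrite Rabs_pos_eq; lra) (4 * (P + rho) / rho + 1)) as [N HN].
  specialize (HN N (le_n N)). rewrite Rabs_pos_eq in HN by (apply pow_le; lra).
  specialize (Hk N).
  apply Rge_le in HN. apply (Rmult_le_compat_r rho) in HN; [|lra].
  replace ((4 * (P + rho) / rho + 1) * rho) with (4 * (P + rho) + rho) in HN by (field; lra).
  lra.
Qed.

(** * Almost sure occurrence of words *)

Definition rsum {X : Type} (f : X -> R) (l : list X) : R :=
  fold_right (fun x r => f x + r) 0 l.

Lemma rsum_app {X} (f : X -> R) l l' : rsum f (l ++ l') = rsum f l + rsum f l'.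
Proof. induction l as [|x l IH]; simpl; [lra|]. rewrite IH. lra. Qed.

Lemma rsum_map {X Y} (f : Y -> R) (h : X -> Y) l :
  rsum f (map h l) = rsum (fun x => f (h x)) l.
Proof. induction l as [|x l IH]; simpl; [|rewrite IH]; reflexivity. Qed.

Lemma rsum_ext_in {X} (f h : X -> R) l :
  (forall x, In x l -> f x = h x) -> rsum f l = rsum h l.
Proof.
  induction l as [|x l IH]; intros H; simpl; [reflexivity|].
  rewrite IH by (intros; apply H; now right). rewrite H by now left. reflexivity.
Qed.

Lemma rsum_le_in {X} (f h : X -> R) l :
  (forall x, In x l -> f x <= h x) -> rsum f l <= rsum h l.
Proof.
  induction l as [|x l IH]; intros H; simpl; [lra|].
  pose proof (H x (or_introl eq_refl)). specialize (IH (fun y Hy => H y (or_intror Hy))). lra.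
Qed.

Lemma rsum_ge0 {X} (f : X -> R) l : (forall x, 0 <= f x) -> 0 <= rsum f l.
Proof. intros H. induction l as [|x l IH]; simpl; [lra|]. specialize (H x). lra. Qed.

Lemma rsum_scal {X} (f : X -> R) c l : rsum (fun x => c * f x) l = c * rsum f l.
Proof. induction l as [|x l IH]; simpl; [|rewrite IH]; lra. Qed.

Lemma rsum_incl {X} (f : X -> R) l l' :
  (forall x, 0 <= f x) -> NoDup l -> incl l l' -> rsum f l <= rsum f l'.
Proof.
  intros Hf. revert l'. induction l as [|x l IH]; intros l' Hnd Hin.
  - now apply rsum_ge0.
  - inversion Hnd; subst.
    destruct (in_split x l') as [l1 [l2 ->]]; [apply Hin; now left|].
    specialize (IH (l1 ++ l2)). rewrite !rsum_app in *. simpl.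
    enough (rsum f l <= rsum f l1 + rsum f l2) by lra.
    apply IH; [easy|]. intros y Hy.
    specialize (Hin y (or_intror Hy)). apply in_app_or in Hin. apply in_or_app.
    destruct Hin as [Hin|[->|Hin]]; tauto.
Qed.

Lemma rsum_list_prod {X Y} (f : X * Y -> R) l l' :
  rsum f (list_prod l l') = rsum (fun x => rsum (fun y => f (x, y)) l') l.
Proof.
  induction l as [|x l IH]; simpl; [reflexivity|].
  now rewrite rsum_app, rsum_map, IH.
Qed.

Lemma sum_n_rsum (f : nat -> R) K : sum_n f K = rsum f (seq 0 (S K)).
Proof.
  induction K as [|K IH].
  - rewrite sum_n_0. simpl. lra.
  - rewrite sum_n_S, IH, (seq_S (S K)), rsum_app. simpl. lra.
Qed.

Definition letter_weight (m : nat) (p : nat -> R) (a : nat) : R :=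
  if andb (Nat.leb 1 a) (Nat.leb a m) then p a else 0.

Definition word_weight (m : nat) (p : nat -> R) (l : list nat) : R :=
  fold_right (fun a r => letter_weight m p a * r) 1 l.

Lemma word_weight_app m p l l' :
  word_weight m p (l ++ l') = word_weight m p l * word_weight m p l'.
Proof. induction l as [|a l IH]; simpl; [lra|]. rewrite IH. lra. Qed.

Lemma prod_letter_weight m p l N : length l = S N ->
  prod_f_R0 (fun i => letter_weight m p (nth i l 0%nat)) N = word_weight m p l.
Proof.
  revert N. induction l as [|a l IH] using rev_ind; intros N HN; [discriminate|].
  rewrite length_app in HN. simpl in HN. rewrite word_weight_app. simpl.
  destruct N as [|N].
  - destruct l; [|simpl in HN; lia]. simpl. lra.
  - simpl prod_f_R0. rewrite <- (IH N) by lia.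
    rewrite app_nth2 by lia. replace (S N - length l)%nat with 0%nat by lia. simpl nth.
    rewrite Rmult_1_r. f_equal.
    assert (E : forall M, (M <= N)%nat ->
      prod_f_R0 (fun i => letter_weight m p (nth i (l ++ a :: nil) 0%nat)) M
      = prod_f_R0 (fun i => letter_weight m p (nth i l 0%nat)) M).
    { induction M as [|M IHM]; intros HM; simpl.
      - rewrite app_nth1 by lia. reflexivity.
      - rewrite IHM by lia. rewrite app_nth1 by lia. reflexivity. }
    now apply E.
Qed.

Definition mass (m : nat) (p : nat -> R) (B : list (list nat)) : R := rsum (word_weight m p) B.

Definition cat (B B' : list (list nat)) : list (list nat) :=
  flat_map (fun x => map (app x) B') B.

Fixpoint power (B : list (list nat)) (n : nat) : list (list nat) :=
  match n with O => nil :: nil | S n => cat B (power B n) end.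

Definition letters (m : nat) : list (list nat) := map (fun a => a :: nil) (seq 1 m).

Lemma in_cat B B' x : In x (cat B B') <-> exists y y', In y B /\ In y' B' /\ x = y ++ y'.
Proof.
  unfold cat. rewrite in_flat_map. split.
  - intros [y [Hy H]]. apply in_map_iff in H. destruct H as [y' [<- Hy']]. now exists y, y'.
  - intros [y [y' [Hy [Hy' ->]]]]. exists y. split; [easy|]. now apply in_map.
Qed.

Lemma length_power B l n x :
  (forall y, In y B -> length y = l) -> In x (power B n) -> length x = (l * n)%nat.
Proof.
  intros HB. revert x. induction n as [|n IH]; intros x Hx; simpl in Hx.
  - destruct Hx as [<-|[]]. simpl. lia.
  - apply in_cat in Hx. destruct Hx as [y [y' [Hy [Hy' ->]]]].
    rewrite length_app, (HB y Hy), (IH y' Hy'). lia.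
Qed.

Lemma mass_cat m p B B' : mass m p (cat B B') = mass m p B * mass m p B'.
Proof.
  unfold mass, cat. induction B as [|x B IH]; simpl; [lra|].
  rewrite rsum_app, IH, rsum_map.
  rewrite (rsum_ext_in _ (fun y => word_weight m p x * word_weight m p y))
    by (intros; apply word_weight_app).
  rewrite rsum_scal. lra.
Qed.

Lemma mass_power m p B n : mass m p (power B n) = mass m p B ^ n.
Proof.
  induction n as [|n IH]; simpl.
  - unfold mass; simpl. lra.
  - now rewrite mass_cat, IH.
Qed.

Lemma mass_letters m p : sum_n_m p 1 m = 1 -> mass m p (letters m) = 1.
Proof.
  intros <-. unfold mass, letters. rewrite rsum_map.
  rewrite (rsum_ext_in _ p).
  - assert (E : forall k, rsum p (seq 1 k) = sum_n_m p 1 k).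
    { induction k as [|k IH].
      - rewrite sum_n_m_zero by lia. reflexivity.
      - rewrite seq_S, rsum_app, IH, (sum_n_Sm p 1 k) by lia.
        change (1 + k)%nat with (S k). unfold plus; simpl. lra. }
    apply E.
  - intros a Ha. apply in_seq in Ha. simpl. unfold letter_weight.
    destruct (Nat.leb_spec 1 a), (Nat.leb_spec a m); try lia. simpl. lra.
Qed.

Fixpoint segment (f : Z -> nat) (s : Z) (n : nat) : list nat :=
  match n with O => nil | S n => f s :: segment f (s + 1)%Z n end.

Lemma nth_segment f s n i : (i < n)%nat -> nth i (segment f s n) 0%nat = f (s + Z.of_nat i)%Z.
Proof.
  revert s i. induction n as [|n IH]; intros s i Hi; [lia|].
  destruct i as [|i]; simpl.
  - f_equal. lia.
  - rewrite IH by lia. f_equal. lia.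
Qed.

Lemma segment_app f s n n' :
  segment f s (n + n') = segment f s n ++ segment f (s + Z.of_nat n)%Z n'.
Proof.
  revert s. induction n as [|n IH]; intros s.
  - simpl. now rewrite Z.add_0_r.
  - simpl plus. simpl segment. rewrite IH, <- app_comm_cons. do 3 f_equal. lia.
Qed.

Lemma segment_in_words m f s n :
  (forall i, (1 <= f i <= m)%nat) -> In (segment f s n) (power (letters m) n).
Proof.
  intros Hf. revert s. induction n as [|n IH]; intros s; simpl; [now left|].
  apply in_cat. exists (f s :: nil), (segment f (s + 1)%Z n).
  split; [|split; [apply IH | reflexivity]].
  unfold letters. apply in_map_iff. exists (f s). split; [reflexivity|].
  apply in_seq. specialize (Hf s). lia.
Qed.

Lemma segment_in_power B l f s n :
  (forall t, (t < n)%nat -> In (segment f (s + Z.of_nat (l * t))%Z l) B) ->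
  In (segment f s (l * n)) (power B n).
Proof.
  revert s. induction n as [|n IH]; intros s H.
  - rewrite Nat.mul_0_r. now left.
  - rewrite Nat.mul_succ_r, Nat.add_comm, segment_app. simpl. apply in_cat.
    exists (segment f s l), (segment f (s + Z.of_nat l)%Z (l * n)).
    split; [|split; [|reflexivity]].
    + specialize (H 0%nat ltac:(lia)). rewrite Nat.mul_0_r in H. simpl in H.
      now rewrite Z.add_0_r in H.
    + apply IH. intros t Ht. specialize (H (S t) ltac:(lia)).
      replace (s + Z.of_nat l + Z.of_nat (l * t))%Z with (s + Z.of_nat (l * S t))%Z by lia.
      exact H.
Qed.

Definition cylinder_of (k : nat) (j : Z) (x : list nat) : cyl :=
  (k, fun n => nth (Z.to_nat (n + Z.of_nat k)) x 0%nat, j).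

Lemma in_cylinder_of k w :
  in_cyl (cylinder_of k (snd w) (segment (fst w) (- Z.of_nat k) (2 * k + 1))) w.
Proof.
  simpl. split; [reflexivity|]. intros n Hn. rewrite nth_segment by lia. f_equal. lia.
Qed.

Lemma nu_cylinder_of m p k j x : (j = 0 \/ j = 1)%Z -> length x = (2 * k + 1)%nat ->
  nu_cyl m p (cylinder_of k j x) = / 2 * word_weight m p x.
Proof.
  intros Hj Hx. unfold nu_cyl, cylinder_of.
  replace (orb (Z.eqb j 0) (Z.eqb j 1)) with true by (destruct Hj; subst; reflexivity).
  rewrite <- (prod_letter_weight m p x (2 * k)) by lia.
  f_equal. f_equal. apply functional_extensionality. intros i. unfold letter_weight.
  replace (Z.to_nat (Z.of_nat i - Z.of_nat k + Z.of_nat k)) with i by lia. reflexivity.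
Qed.

Section Measure.
Variables (m : nat) (p : nat -> R).
Hypothesis (hp : forall a : nat, (1 <= a <= m)%nat -> 0 < p a).
Hypothesis (hsum : sum_n_m p 1 m = 1).

Lemma letter_weight_ge0 a : 0 <= letter_weight m p a.
Proof.
  unfold letter_weight.
  destruct (Nat.leb_spec 1 a), (Nat.leb_spec a m); simpl; try lra.
  apply Rlt_le, hp. lia.
Qed.

Lemma word_weight_ge0 x : 0 <= word_weight m p x.
Proof.
  induction x as [|a x IH]; simpl; [lra|].
  apply Rmult_le_pos; [apply letter_weight_ge0 | exact IH].
Qed.

Lemma word_weight_segment_pos f s n :
  (forall i, (1 <= f i <= m)%nat) -> 0 < word_weight m p (segment f s n).
Proof.
  intros Hf. revert s. induction n as [|n IH]; intros s; simpl; [lra|].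
  apply Rmult_lt_0_compat; [|apply IH].
  unfold letter_weight. specialize (Hf s).
  destruct (Nat.leb_spec 1 (f s)), (Nat.leb_spec (f s) m); try lia. simpl. now apply hp.
Qed.

Lemma mass_words n : mass m p (power (letters m) n) = 1.
Proof. now rewrite mass_power, mass_letters, pow1. Qed.

Lemma nu_cyl_ge0 c : 0 <= nu_cyl m p c.
Proof.
  destruct c as [[k u] j]. unfold nu_cyl. apply Rmult_le_pos.
  - destruct (_ || _)%bool; lra.
  - generalize (2 * k)%nat as N.
    assert (H : forall i : nat, 0 <= letter_weight m p (u (Z.of_nat i - Z.of_nat k)%Z))
      by (intros; apply letter_weight_ge0).
    unfold letter_weight in H.
    induction N as [|N IH]; simpl prod_f_R0; [apply (H 0%nat)|].
    apply Rmult_le_pos; [exact IH | apply (H (S N))].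
Qed.

Lemma nu_null_subset (M N : pt -> Prop) :
  (forall w, in_X m w -> M w -> N w) -> nu_null m p N -> nu_null m p M.
Proof.
  intros H HN eps He. destruct (HN eps He) as [c [Hc Hs]]. exists c. split; [|exact Hs].
  intros w Hw HMw. apply Hc; auto.
Qed.

Lemma nu_null_finite_cover (N : pt -> Prop) :
  (forall eps, 0 < eps -> exists l : list cyl,
     (forall w, in_X m w -> N w -> exists c, In c l /\ in_cyl c w) /\
     rsum (nu_cyl m p) l <= eps) ->
  nu_null m p N.
Proof.
  intros H eps He. destruct (H eps He) as [l [Hl Hs]].
  set (c0 := ((0%nat, fun _ => 0%nat, 2%Z) : cyl)).
  assert (Hc0 : nu_cyl m p c0 = 0) by (simpl; lra).
  exists (fun i => nth i l c0). split.
  - intros w Hw HNw. destruct (Hl w Hw HNw) as [c [Hc Hcw]].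
    destruct (In_nth l c c0 Hc) as [i [_ Hi]]. exists i. now rewrite Hi.
  - intros K. eapply Rle_trans; [|exact Hs]. clear - Hc0 hp. rewrite sum_n_rsum.
    generalize (S K) as n. clear K. intros n. revert n. induction l as [|c l IH]; intros n.
    + simpl rsum at 2. apply Req_le.
      rewrite (rsum_ext_in _ (fun _ => 0 * 0)), rsum_scal; [lra|].
      intros [|i] _; simpl nth; rewrite Hc0; lra.
    + destruct n as [|n].
      * apply rsum_ge0. apply nu_cyl_ge0.
      * simpl. rewrite <- seq_shift, rsum_map. specialize (IH n). lra.
Qed.

Lemma nu_null_union (N : nat -> pt -> Prop) :
  (forall i, nu_null m p (N i)) -> nu_null m p (fun w => exists i, N i w).
Proof.
  intros H eps He.
  assert (Hc : forall i, exists c : nat -> cyl,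
    (forall w, in_X m w -> N i w -> exists k, in_cyl (c k) w) /\
    forall K, sum_n (fun k => nu_cyl m p (c k)) K <= eps * (/ 2) ^ S i).
  { intros i. apply H. apply Rmult_lt_0_compat; [easy|]. apply pow_lt. lra. }
  set (c := fun i => proj1_sig (constructive_indefinite_description _ (Hc i))).
  assert (Hcs : forall i, (forall w, in_X m w -> N i w -> exists k, in_cyl (c i k) w) /\
    forall K, sum_n (fun k => nu_cyl m p (c i k)) K <= eps * (/ 2) ^ S i).
  { intros i. unfold c. apply proj2_sig. }
  clearbody c. clear Hc.
  exists (fun n => c (fst (Cantor.of_nat n)) (snd (Cantor.of_nat n))). split.
  - intros w Hw [i Hi]. destruct (proj1 (Hcs i) w Hw Hi) as [k Hk].
    exists (Cantor.to_nat (i, k)). now rewrite Cantor.cancel_of_to.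
  - intros K. rewrite sum_n_rsum.
    apply Rle_trans with
      (rsum (fun q => nu_cyl m p (c (fst q) (snd q)))
         (list_prod (seq 0 (S K)) (seq 0 (S K)))).
    + rewrite <- (rsum_map (fun q => nu_cyl m p (c (fst q) (snd q))) Cantor.of_nat).
      apply rsum_incl.
      * intros; apply nu_cyl_ge0.
      * apply Injective_map_NoDup; [|apply seq_NoDup].
        intros a b Hab. rewrite <- (Cantor.cancel_to_of a), <- (Cantor.cancel_to_of b).
        now rewrite Hab.
      * intros q Hq. apply in_map_iff in Hq. destruct Hq as [n [<- Hn]].
        apply in_seq in Hn. pose proof (Cantor.cancel_to_of n) as Hcn.
        destruct (Cantor.of_nat n) as [x y].
        pose proof (Cantor.to_nat_non_decreasing x y).
        apply in_prod; apply in_seq; lia.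
    + rewrite rsum_list_prod. simpl fst. simpl snd.
      apply Rle_trans with (rsum (fun i => eps * (/ 2) ^ S i) (seq 0 (S K))).
      * apply rsum_le_in. intros i _. rewrite <- sum_n_rsum. apply Hcs.
      * rewrite rsum_scal, <- sum_n_rsum.
        assert (E : sum_n (fun i => (/ 2) ^ S i) K = 1 - (/ 2) ^ S K).
        { clear. induction K as [|K IH]; [rewrite sum_n_0; simpl; lra|].
          rewrite sum_n_S, IH. simpl. lra. }
        rewrite E. assert (0 < (/ 2) ^ S K) by (apply pow_lt; lra). nra.
Qed.

Lemma mass_filter_neq W B : In W B ->
  mass m p (filter (fun x => if list_eq_dec Nat.eq_dec x W then false else true) B)
  + word_weight m p W <= mass m p B.
Proof.
  unfold mass.
  assert (Hle : forall B, rsum (word_weight m p)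
    (filter (fun x => if list_eq_dec Nat.eq_dec x W then false else true) B)
    <= rsum (word_weight m p) B).
  { intros B'. induction B' as [|x B' IH]; simpl; [lra|].
    pose proof (word_weight_ge0 x).
    destruct (list_eq_dec Nat.eq_dec x W); simpl; lra. }
  induction B as [|x B IH]; intros HW; simpl; [easy|].
  destruct (list_eq_dec Nat.eq_dec x W) as [->|Hne]; simpl.
  - specialize (Hle B). lra.
  - destruct HW as [HW|HW]; [now subst|]. specialize (IH HW). lra.
Qed.

Lemma word_avoiding_null (jn l : nat) (W : list nat) :
  (jn <= 1)%nat -> (1 <= l)%nat -> In W (power (letters m) l) -> 0 < word_weight m p W ->
  nu_null m p (fun w => snd w = Z.of_nat jn /\
    forall t : nat, segment (fst w) (Z.of_nat jn + Z.of_nat (l * t)) l <> W).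
Proof.
  intros Hj Hl HW Hpos. apply nu_null_finite_cover. intros eps He.
  set (B := filter (fun x => if list_eq_dec Nat.eq_dec x W then false else true)
              (power (letters m) l)).
  assert (HB1 : mass m p B + word_weight m p W <= 1).
  { rewrite <- (mass_words l). now apply mass_filter_neq. }
  assert (HB0 : 0 <= mass m p B) by (apply rsum_ge0, word_weight_ge0).
  destruct (pow_lt_1_zero (mass m p B) ltac:(rewrite Rabs_pos_eq; lra) eps He) as [T HT].
  specialize (HT (S T) ltac:(lia)). rewrite Rabs_pos_eq in HT by (apply pow_le; exact HB0).
  set (k := (jn + l * S T - 1)%nat).
  assert (Hk : (2 * k + 1 = (k + jn) + l * S T)%nat) by (unfold k; nia).
  set (C := cat (power (letters m) (k + jn)) (power B (S T))).
  assert (Hlet : forall n y, In y (power (letters m) n) -> length y = n).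
  { intros n y Hy. rewrite (length_power (letters m) 1 n y); [lia| |exact Hy].
    intros x Hx. unfold letters in Hx. apply in_map_iff in Hx. now destruct Hx as [a [<- _]]. }
  assert (HC : forall x, In x C -> length x = (2 * k + 1)%nat).
  { intros x Hx. apply in_cat in Hx. destruct Hx as [y [y' [Hy [Hy' ->]]]].
    rewrite length_app, (Hlet _ _ Hy), (length_power B l (S T) y'); [lia| |exact Hy'].
    intros z Hz. apply filter_In in Hz. now apply Hlet. }
  exists (map (cylinder_of k (Z.of_nat jn)) C). split.
  - intros w [Hw _] [Hjw Hav].
    exists (cylinder_of k (snd w) (segment (fst w) (- Z.of_nat k) (2 * k + 1))).
    split; [|apply in_cylinder_of].
    rewrite Hjw. apply in_map. rewrite Hk, segment_app. apply in_cat.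
    eexists _, _. split; [|split; [|reflexivity]].
    + now apply segment_in_words.
    + apply segment_in_power. intros t _.
      replace (- Z.of_nat k + Z.of_nat (k + jn))%Z with (Z.of_nat jn) by lia.
      apply filter_In. split; [now apply segment_in_words|].
      destruct (list_eq_dec Nat.eq_dec _ W) as [E|]; [now apply Hav in E | reflexivity].
  - rewrite rsum_map, (rsum_ext_in _ (fun x => / 2 * word_weight m p x)).
    + rewrite rsum_scal. change (rsum (word_weight m p) C) with (mass m p C).
      unfold C. rewrite mass_cat, mass_words, mass_power. lra.
    + intros x Hx. apply nu_cylinder_of; [lia | now apply HC].
Qed.

End Measure.

Definition alternating (a b : nat) (i : Z) : nat := if Z.even i then a else b.

Definition has_block (w : pt) (a b L : nat) : Prop :=
  exists t : nat, segment (fst w) (snd w + Z.of_nat (2 * S L * t)) (2 * S L)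
                  = segment (alternating a b) 0 (2 * S L).

Lemma has_all_blocks_ae (m : nat) (p : nat -> R) :
  (forall a : nat, (1 <= a <= m)%nat -> 0 < p a) -> sum_n_m p 1 m = 1 ->
  nu_ae m p (fun w => forall a b L, (1 <= a <= m)%nat -> (1 <= b <= m)%nat -> has_block w a b L).
Proof.
  intros hp hsum.
  assert (Hbad : forall jn a b L : nat, nu_null m p (fun w =>
    (1 <= a <= m)%nat /\ (1 <= b <= m)%nat /\ snd w = Z.of_nat jn /\ ~ has_block w a b L)).
  { intros jn a b L.
    destruct (classic ((jn <= 1)%nat /\ (1 <= a <= m)%nat /\ (1 <= b <= m)%nat))
      as [[Hj [Ha Hb]]|Hno].
    - assert (Hab : forall i, (1 <= alternating a b i <= m)%nat)
        by (intros i; unfold alternating; destruct (Z.even i); easy).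
      refine (nu_null_subset m p _ _ _
        (word_avoiding_null m p hp hsum jn (2 * S L) (segment (alternating a b) 0 (2 * S L))
           Hj ltac:(lia) _ _)).
      + intros w _ [_ [_ [Hjw Hnb]]]. split; [exact Hjw|].
        intros t Ht. apply Hnb. exists t. now rewrite Hjw.
      + now apply segment_in_words.
      + now apply word_weight_segment_pos.
    - apply nu_null_finite_cover; [exact hp|].
      intros eps He. exists nil. split; [|simpl; lra].
      intros w [_ Hw] [Ha [Hb [Hj _]]]. exfalso. apply Hno. repeat split; lia. }
  unfold nu_ae.
  refine (nu_null_subset m p _ (fun w => exists jn a b L : nat,
    (1 <= a <= m)%nat /\ (1 <= b <= m)%nat /\ snd w = Z.of_nat jn /\ ~ has_block w a b L) _ _).
  - intros w [_ Hj] Hnot. apply NNPP. intros Hno. apply Hnot. intros a b L Ha Hb.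
    apply NNPP. intros Hnb. apply Hno.
    exists (Z.to_nat (snd w)), a, b, L. repeat split; try easy. lia.
  - do 4 (apply nu_null_union; [exact hp|]; intros ?). apply Hbad.
Qed.

Lemma blocks_discriminant_in_spectrum (g : nat -> Z -> R) w E a b :
  (snd w = 0 \/ snd w = 1)%Z ->
  (forall L, has_block w a b L) ->
  0 <= (E - g a 0%Z) * (E - g b 1%Z) <= 4 ->
  in_spectrum (Vpot g w) (RtoC E).
Proof.
  intros Hj Hblocks HE.
  apply long_blocks_in_spectrum with
    (alpha := if Z.eqb (snd w) 0 then g a 0%Z else g b 1%Z)
    (beta := if Z.eqb (snd w) 0 then g b 1%Z else g a 0%Z).
  - destruct Hj as [-> | ->]; simpl; lra.
  - intros L. destruct (Hblocks L) as [t Ht].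
    exists (Z.to_nat (snd w + Z.of_nat (2 * S L * t))). intros n Hn.
    set (i := (n - Z.to_nat (snd w + Z.of_nat (2 * S L * t)))%nat).
    assert (Hi : (i < 2 * S L)%nat) by (unfold i; lia).
    apply (f_equal (fun l => nth i l 0%nat)) in Ht. rewrite !nth_segment in Ht by exact Hi.
    assert (Hni : Z.of_nat n = (snd w + Z.of_nat (2 * S L * t) + Z.of_nat i)%Z) by (unfold i; lia).
    rewrite Vpot_eq, Hni, Ht. clearbody i. rewrite Z.add_0_l. unfold alternating.
    assert (Hev : Nat.even n = Z.even (snd w + Z.of_nat i)).
    { rewrite <- (Z.even_add_mul_2 (snd w + Z.of_nat i) (Z.of_nat (S L * t))).
      replace (snd w + Z.of_nat i + 2 * Z.of_nat (S L * t))%Z with (Z.of_nat n) by lia.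
      clear. induction n as [| |n IH] using nat_ind2; try reflexivity.
      change (Nat.even (S (S n))) with (Nat.even n). rewrite IH.
      replace (Z.of_nat (S (S n))) with (Z.of_nat n + 2 * 1)%Z by lia.
      now rewrite Z.even_add_mul_2. }
    rewrite Hev, Z.even_add.
    replace ((snd w + (snd w + Z.of_nat (2 * S L * t) + Z.of_nat i)) mod 2)%Z
      with (Z.of_nat i mod 2)%Z.
    2: { replace (snd w + (snd w + Z.of_nat (2 * S L * t) + Z.of_nat i))%Z
           with (Z.of_nat i + (snd w + Z.of_nat (S L * t)) * 2)%Z by lia.
         now rewrite Z.mod_add by lia. }
    rewrite Zmod_even. destruct Hj as [-> | ->]; destruct (Z.even (Z.of_nat i)); reflexivity.
Qed.

Lemma omega_ab_has_blocks a b L : has_block (omega_ab a b) a b L.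
Proof. exists 0%nat. rewrite Nat.mul_0_r. reflexivity. Qed.

Lemma omega_ab_in_X m a b : (1 <= a <= m)%nat -> (1 <= b <= m)%nat -> in_X m (omega_ab a b).
Proof.
  intros Ha Hb. split; [|now left]. intros n. simpl. destruct (Z.even n); easy.
Qed.

Theorem theorem3p51 (m : nat) (p : nat -> R) (g : nat -> Z -> R)
  (hp : forall a : nat, (1 <= a <= m)%nat -> 0 < p a)
  (hsum : sum_n_m p 1 m = 1) :
  nu_ae m p (fun w => forall z : C,
      in_spectrum (Vpot g w) z <->
      exists a b : nat, (1 <= a <= m)%nat /\ (1 <= b <= m)%nat /\
        in_spectrum (Vpot g (omega_ab a b)) z)
  /\
  (forall w : pt, in_X m w -> forall z : C,
      in_spectrum (Vpot g w) z ->
      exists a b : nat, (1 <= a <= m)%nat /\ (1 <= b <= m)%nat /\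
        in_spectrum (Vpot g (omega_ab a b)) z).
Proof.
  assert (Hincl : forall w : pt, in_X m w -> forall z : C,
      in_spectrum (Vpot g w) z ->
      exists a b : nat, (1 <= a <= m)%nat /\ (1 <= b <= m)%nat /\
        in_spectrum (Vpot g (omega_ab a b)) z).
  { intros w Hw z Hz.
    destruct (spectrum_discriminant m g w z Hw Hz) as [E [a [b [-> [Ha [Hb HE]]]]]].
    exists a, b. split; [exact Ha|]. split; [exact Hb|].
    apply (blocks_discriminant_in_spectrum g _ E a b); [now left| |exact HE].
    apply omega_ab_has_blocks. }
  split; [|exact Hincl].
  refine (nu_null_subset m p _ _ _ (has_all_blocks_ae m p hp hsum)).
  intros w Hw Hnot Hblocks. apply Hnot. intros z. split; [apply Hincl, Hw|].
  intros [a [b [Ha [Hb Hz]]]].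
  destruct (spectrum_discriminant m g _ z (omega_ab_in_X m a b Ha Hb) Hz)
    as [E [a' [b' [-> [Ha' [Hb' HE]]]]]].
  apply (blocks_discriminant_in_spectrum g w E a' b'); [apply Hw| |exact HE].
  intros L. now apply Hblocks.
Qed.
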